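(* Geodesic-preserving functions $f\in GP(\mathfrak{G}^{\mathbb{D}}_a,\mathfrak{G}^{\mathbb{D}}_b)$, where $a,b\in\partial\mathbb{D}$, are of the form $f=\sigma\circ T_a$, where $\sigma$ is a rotation mapping $a$ to $b$ and $T_a$ is a Möbius transformation of the closed unit disc fixing $a$, that is, a fractional linear self-map of the unit disc with $T_a(a)=a$.
   Context: $\mathbb{D}$ is the open unit disc in $\mathbb{C}$. A geodesic between two points of a domain $\Omega$ is the length-minimizing curve joining them for the Kobayashi metric $k_\Omega$; a geodesic line is a geodesic defined on the whole real axis, with its limits at $\pm\infty$ lying on $\partial\Omega$. Geodesics are identified with their images. For $a\in\overline{\Omega}$, $\mathfrak{G}^{\Omega}_a$ is the family of all images $\gamma$ of geodesic lines in $\Omega$ with $a\in\overline{\gamma}$. Given families $\mathfrak{F}_1,\mathfrak{F}_2$ of geodesics in $\Omega_1,\Omega_2$, a holomorphic map $f:\Omega_1\to\Omega_2$ is geodesic-preserving, written $f\in GP(\mathfrak{F}_1,\mathfrak{F}_2)$, if for every $\gamma_1\in\mathfrak{F}_1$ there exists $\gamma_2\in\mathfrak{F}_2$ with $f(\gamma_1)\subset\gamma_2$. The term Möbius transformation here means a fractional linear self-map of the unit disc; the automorphisms of the unit disc form a smaller class.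
   Formalization: The function f is assumed non-constant: a constant map into the disc preserves geodesics in the stated sense but is not a rotation composed with a fractional linear self-map of the disc fixing the boundary point a. *)

(* Defs.v *)
From Stdlib Require Import Reals.
From Coquelicot Require Import Coquelicot.

Open Scope R_scope.

(** * Subsets of the complex plane *)

Definition Disc (z : C) : Prop := Cmod z < 1.

Definition closure (A : C -> Prop) (z : C) : Prop :=
  forall P : C -> Prop, locally z P -> exists w : C, P w /\ A w.

Definition frontier (A : C -> Prop) (z : C) : Prop :=
  closure A z /\ closure (fun w => ~ A w) z.

(** * Holomorphic maps *)

(** Maps between domains are total functions of which only the restriction to
    the source matters. *)
Definition holomorphic_on (Omega : C -> Prop) (f : C -> C) : Prop :=
  forall z : C, Omega z -> ex_derive (K := C_AbsRing) (V := C_NormedModule) f z.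

Definition holomorphic_map (Omega1 Omega2 : C -> Prop) (f : C -> C) : Prop :=
  holomorphic_on Omega1 f /\ (forall z : C, Omega1 z -> Omega2 (f z)).

(** * The Kobayashi metric *)

(** artanh |(p - q) / (1 - conj(q) p)|; only meaningful for p, q in the disc. *)
Definition poincare_dist (p q : C) : R :=
  let delta := Cmod ((p - q) / (1 - Cconj q * p))%C in
  / 2 * ln ((1 + delta) / (1 - delta)).

(** [disc_chain Omega z w l]: z and w are joined in Omega by a finite chain of
    holomorphic discs of total Poincare length l. *)
Inductive disc_chain (Omega : C -> Prop) : C -> C -> R -> Prop :=
| disc_chain_refl : forall z : C, Omega z -> disc_chain Omega z z 0
| disc_chain_step : forall (phi : C -> C) (p q w : C) (l : R),
    holomorphic_map Disc Omega phi -> Disc p -> Disc q ->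
    disc_chain Omega (phi q) w l ->
    disc_chain Omega (phi p) w (poincare_dist p q + l).

(** The infimum is finite whenever z and w can be joined by a chain, in
    particular for all points of a domain Omega (open, connected). *)
Definition kobayashi (Omega : C -> Prop) (z w : C) : R :=
  real (Glb_Rbar (disc_chain Omega z w)).

(** * Geodesics *)

(** Length of gamma on [s, t] for the Kobayashi metric: supremum over the
    subdivisions s = x 0 <= ... <= x (n + 1) = t. *)
Definition kobayashi_length (Omega : C -> Prop) (gamma : R -> C) (s t : R) : Rbar :=
  Lub_Rbar (fun l : R => exists (n : nat) (x : nat -> R),
    x 0%nat = s /\ x (S n) = t /\
    (forall i : nat, (i <= n)%nat -> x i <= x (S i)) /\
    l = sum_f_R0 (fun i => kobayashi Omega (gamma (x i)) (gamma (x (S i)))) n).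

Definition curve_in (Omega : C -> Prop) (gamma : R -> C) (s t : R) : Prop :=
  continuous_on (fun r => s <= r <= t) gamma /\
  (forall r : R, s <= r <= t -> Omega (gamma r)).

Definition geodesic_segment (Omega : C -> Prop) (gamma : R -> C) (s t : R) : Prop :=
  curve_in Omega gamma s t /\
  (forall (eta : R -> C) (u v : R),
    u <= v -> curve_in Omega eta u v -> eta u = gamma s -> eta v = gamma t ->
    Rbar_le (kobayashi_length Omega gamma s t) (kobayashi_length Omega eta u v)).

(** The parametrization is left free, since only images of geodesics are used. *)
Definition geodesic_line (Omega : C -> Prop) (gamma : R -> C) : Prop :=
  (forall s t : R, s <= t -> geodesic_segment Omega gamma s t) /\
  (exists p : C, frontier Omega p /\
    filterlim gamma (Rbar_locally m_infty) (locally p)) /\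
  (exists q : C, frontier Omega q /\
    filterlim gamma (Rbar_locally p_infty) (locally q)).

(** The family of images of the geodesic lines of Omega whose closure
    contains a. *)
Definition geodesics_through (Omega : C -> Prop) (a : C) (Gamma : C -> Prop) : Prop :=
  (exists gamma : R -> C, geodesic_line Omega gamma /\
    (forall z : C, Gamma z <-> exists t : R, z = gamma t)) /\
  closure Gamma a.

Definition geodesic_preserving (Omega1 Omega2 : C -> Prop)
    (F1 F2 : (C -> Prop) -> Prop) (f : C -> C) : Prop :=
  holomorphic_map Omega1 Omega2 f /\
  (forall Gamma1 : C -> Prop, F1 Gamma1 ->
    exists Gamma2 : C -> Prop, F2 Gamma2 /\
      forall z : C, Gamma1 z -> Gamma2 (f z)).

(** * Rotations and Moebius transformations *)

Definition rotation (sigma : C -> C) : Prop :=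
  exists c : C, Cmod c = 1 /\ forall z : C, sigma z = (c * z)%C.

(** Fractional linear self-maps of the disc, not necessarily onto; the formula
    is required on the closed disc, so that boundary values make sense. *)
Definition moebius_self_map (T : C -> C) : Prop :=
  (exists alpha beta gamma delta : C,
    (alpha * delta - beta * gamma)%C <> 0%C /\
    forall z : C, Cmod z <= 1 ->
      (gamma * z + delta)%C <> 0%C /\
      T z = ((alpha * z + beta) / (gamma * z + delta))%C) /\
  (forall z : C, Disc z -> Disc (T z)).

(* Main.v *)
Require Import Defs.
From Stdlib Require Import Reals Lra Lia Classical ClassicalEpsilon.
From Coquelicot Require Import Coquelicot.

(** Write [H_b z = (b + z) / (b - z)]: this map carries the disc onto the right half-plane and the
boundary point [b] to infinity. The geodesic lines ending at [b] become the horizontal rays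
[Im w = const]. A holomorphic map [f] carrying the geodesics through [a] into geodesics through [b]
is therefore a holomorphic map [F] of the half-plane into itself such that [Im F] depends on [Im w]
alone. By the Cauchy-Riemann equations [F'] is then real, [Re F] depends on [Re w] alone, and the
derivatives of [Re F] and [Im F] along the axes are equal functions of independent variables, hence
one constant [k]; so [F w = k w + c] ([affine_of_Im_horizontal]). Since [F] preserves the half-plane,
[k >= 0] and [Re c >= 0], and [k > 0] unless [f] is constant. Going back to the disc at [a] instead
of [b] gives the Moebius map [T], which fixes [a] because [w |-> k w + c] fixes infinity; the
rotation by [b / a] accounts for the change of boundary point.

The work lies in identifying the geodesics.

- The Kobayashi distance of the disc is the Poincare distance ([kobayashi_disc]): no chain of discs
  is shorter, by the Schwarz-Pick lemma and the triangle inequality.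
- Schwarz-Pick needs complex analysis for maps that are only assumed to be complex differentiable.
  If [g] maps the disc to itself and fixes 0, then [g (e^w) e^(-w)] is [2 pi i]-periodic, so by
  Goursat's lemma ([goursat]) its means over vertical periods do not depend on [Re w]; they tend to
  [g' 0] as [Re w -> -oo] and have modulus at most [e^(-Re w)], whence [|g' 0| <= 1]
  ([schwarz_derivative]). Conjugating by disc automorphisms gives the infinitesimal Schwarz-Pick
  inequality, and integrating it along a radius gives the Schwarz lemma ([schwarz]) without any
  maximum principle or removable singularity.
- The triangle inequality and its equality case both come from one Gram determinant in the
  hyperboloid model ([gram_identity]): in case of equality the three points are linearly dependent
  there. Hence any three points of a geodesic line satisfy [collinearity p q r = 0]. Letting [r] tend
  to the boundary point [b] in this polynomial relation gives [Im (H_b p) = Im (H_b q)]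
  ([Im_half_plane_const]). Conversely horizontal rays are minimizing, because the Poincare distance
  is additive along them ([ray_geodesic_line]). *)

Open Scope R_scope.

(** * Complex differentiability *)

(** Complex differentiability in epsilon-delta form, with the modulus as the only measure of
proximity, so that the chain and product rules are plain estimates. *)
Definition cdiff (f : C -> C) (z l : C) : Prop :=
  forall eps : R, 0 < eps -> exists d : R, 0 < d /\
    forall w : C, Cmod (w - z)%C < d ->
      Cmod (f w - f z - l * (w - z))%C <= eps * Cmod (w - z)%C.

Lemma cdiff_of_ex_derive (f : C -> C) (z : C) :
  ex_derive (K := C_AbsRing) (V := C_NormedModule) f z ->
  exists l, cdiff f z l.
Proof.
  intros [l [_ Hl]].
  exists l. intros eps Heps.
  specialize (Hl z (fun P H => H) (mkposreal eps Heps)).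
  destruct Hl as [d Hd]. 
  exists d. split. apply cond_pos.
  intros w Hw. specialize (Hd w Hw). simpl in Hd.
  unfold norm, minus, scal, plus, opp in Hd. simpl in Hd.
  unfold prod_norm in Hd. 
  replace (f w - f z - l * (w - z))%C with (f w + - f z + - ((w + - z) * l))%C by ring.
  exact Hd.
Qed.

Lemma cdiff_lip (f : C -> C) (z l : C) : cdiff f z l ->
  exists d, 0 < d /\ forall w, Cmod (w - z)%C < d ->
    Cmod (f w - f z)%C <= (1 + Cmod l) * Cmod (w - z)%C.
Proof.
  intros H. destruct (H 1 Rlt_0_1) as [d [Hd Hf]].
  exists d. split; [exact Hd|]. intros w Hw. specialize (Hf w Hw).
  replace (f w - f z)%C with ((f w - f z - l * (w - z)) + l * (w - z))%C by ring.
  eapply Rle_trans. apply Cmod_triangle. rewrite (Cmod_mult l). lra.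
Qed.

Lemma cdiff_comp (f g : C -> C) (z l m : C) :
  cdiff g z m -> cdiff f (g z) l -> cdiff (fun w => f (g w)) z (l * m)%C.
Proof.
  intros Hg Hf eps Heps.
  destruct (cdiff_lip g z m Hg) as [d1 [Hd1 H1]].
  pose proof (Cmod_ge_0 l) as Hl0. pose proof (Cmod_ge_0 m) as Hm0.
  set (e1 := eps / (2 * (1 + Cmod m))).
  set (e2 := eps / (2 * (1 + Cmod l))).
  assert (He1 : 0 < e1) by (apply Rdiv_lt_0_compat; lra).
  assert (He2 : 0 < e2) by (apply Rdiv_lt_0_compat; lra).
  assert (E1 : e1 * (1 + Cmod m) = eps / 2) by (unfold e1; field; lra).
  assert (E2 : e2 * (1 + Cmod l) = eps / 2) by (unfold e2; field; lra).
  destruct (Hf e1 He1) as [d2 [Hd2 H2]].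
  destruct (Hg e2 He2) as [d3 [Hd3 H3]].
  exists (Rmin d1 (Rmin d3 (d2 / (1 + Cmod m)))).
  assert (Hd2' : 0 < d2 / (1 + Cmod m)) by (apply Rdiv_lt_0_compat; lra).
  split. repeat apply Rmin_pos; assumption.
  intros w Hw.
  assert (W1 := Rlt_le_trans _ _ _ Hw (Rmin_l _ _)).
  assert (W2 := Rlt_le_trans _ _ _ Hw (Rmin_r _ _)).
  assert (W3 := Rlt_le_trans _ _ _ W2 (Rmin_l _ _)).
  assert (W4 := Rlt_le_trans _ _ _ W2 (Rmin_r _ _)).
  specialize (H1 w W1). specialize (H3 w W3).
  assert (W5 : Cmod (g w - g z)%C < d2).
  { eapply Rle_lt_trans. exact H1.
    apply Rmult_lt_compat_l with (r := 1 + Cmod m) in W4; [|lra].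
    replace ((1 + Cmod m) * (d2 / (1 + Cmod m))) with d2 in W4 by (field; lra). exact W4. }
  specialize (H2 _ W5).
  pose proof (Cmod_ge_0 (w - z)%C) as Hw0.
  replace (f (g w) - f (g z) - l * m * (w - z))%C with
    ((f (g w) - f (g z) - l * (g w - g z)) + l * (g w - g z - m * (w - z)))%C by ring.
  eapply Rle_trans. apply Cmod_triangle. rewrite (Cmod_mult l).
  nra.
Qed.

Lemma cdiff_mult (f g : C -> C) (z l m : C) :
  cdiff f z l -> cdiff g z m ->
  cdiff (fun w => f w * g w)%C z (l * g z + f z * m)%C.
Proof.
  intros Hf Hg eps Heps.
  destruct (cdiff_lip f z l Hf) as [d1 [Hd1 H1]].
  destruct (cdiff_lip g z m Hg) as [d2 [Hd2 H2]].
  pose proof (Cmod_ge_0 l) as Hl0. pose proof (Cmod_ge_0 m) as Hm0.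
  pose proof (Cmod_ge_0 (f z)) as Hfz. pose proof (Cmod_ge_0 (g z)) as Hgz.
  set (e1 := eps / (3 * (1 + Cmod (g z)))).
  set (e2 := eps / (3 * (1 + Cmod (f z)))).
  set (e3 := eps / (3 * ((1 + Cmod l) * (1 + Cmod m)))).
  assert (Hlm : 0 < (1 + Cmod l) * (1 + Cmod m)) by nra.
  assert (He1 : 0 < e1) by (apply Rdiv_lt_0_compat; lra).
  assert (He2 : 0 < e2) by (apply Rdiv_lt_0_compat; lra).
  assert (He3 : 0 < e3) by (apply Rdiv_lt_0_compat; lra).
  assert (E1 : e1 * (1 + Cmod (g z)) = eps / 3) by (unfold e1; field; lra).
  assert (E2 : e2 * (1 + Cmod (f z)) = eps / 3) by (unfold e2; field; lra).
  assert (E3 : e3 * ((1 + Cmod l) * (1 + Cmod m)) = eps / 3) by (unfold e3; field; lra).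
  destruct (Hf e1 He1) as [d3 [Hd3 H3]].
  destruct (Hg e2 He2) as [d4 [Hd4 H4]].
  exists (Rmin (Rmin d1 d2) (Rmin (Rmin d3 d4) e3)).
  split. repeat apply Rmin_pos; assumption.
  intros w Hw.
  assert (W12 := Rlt_le_trans _ _ _ Hw (Rmin_l _ _)).
  assert (W345 := Rlt_le_trans _ _ _ Hw (Rmin_r _ _)).
  assert (W1 := Rlt_le_trans _ _ _ W12 (Rmin_l _ _)).
  assert (W2 := Rlt_le_trans _ _ _ W12 (Rmin_r _ _)).
  assert (W34 := Rlt_le_trans _ _ _ W345 (Rmin_l _ _)).
  assert (W5 := Rlt_le_trans _ _ _ W345 (Rmin_r _ _)).
  assert (W3 := Rlt_le_trans _ _ _ W34 (Rmin_l _ _)).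
  assert (W4 := Rlt_le_trans _ _ _ W34 (Rmin_r _ _)).
  specialize (H1 w W1). specialize (H2 w W2). specialize (H3 w W3). specialize (H4 w W4).
  pose proof (Cmod_ge_0 (w - z)%C) as Hw0.
  pose proof (Cmod_ge_0 (f w - f z)%C) as Hf0.
  pose proof (Cmod_ge_0 (g w - g z)%C) as Hg0.
  replace (f w * g w - f z * g z - (l * g z + f z * m) * (w - z))%C with
    ((f w - f z - l * (w - z)) * g z + f z * (g w - g z - m * (w - z))
     + (f w - f z) * (g w - g z))%C by ring.
  eapply Rle_trans. apply Cmod_triangle.
  eapply Rle_trans. apply Rplus_le_compat_r. apply Cmod_triangle.
  rewrite !Cmod_mult.
  set (D := Cmod (w - z)%C) in *.
  assert (A1 : Cmod (f w - f z - l * (w - z)) * Cmod (g z) <= eps / 3 * D).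
  { apply Rle_trans with ((e1 * D) * Cmod (g z)). apply Rmult_le_compat_r; assumption.
    rewrite <- E1. assert (0 <= e1 * D) by (apply Rmult_le_pos; lra). lra. }
  assert (A2 : Cmod (f z) * Cmod (g w - g z - m * (w - z)) <= eps / 3 * D).
  { apply Rle_trans with (Cmod (f z) * (e2 * D)). apply Rmult_le_compat_l; assumption.
    rewrite <- E2. assert (0 <= e2 * D) by (apply Rmult_le_pos; lra). lra. }
  assert (A3 : Cmod (f w - f z) * Cmod (g w - g z) <= eps / 3 * D).
  { apply Rle_trans with (((1 + Cmod l) * D) * ((1 + Cmod m) * D)).
    apply Rmult_le_compat; assumption.
    replace ((1 + Cmod l) * D * ((1 + Cmod m) * D)) with
      (((1 + Cmod l) * (1 + Cmod m)) * D * D) by ring.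
    rewrite <- E3. 
    apply Rmult_le_compat_r; [assumption|].
    rewrite (Rmult_comm e3). apply Rmult_le_compat_l; lra. }
  lra.
Qed.

Definition moebius (al be ga de z : C) : C := ((al * z + be) / (ga * z + de))%C.

Lemma cdiff_moebius (al be ga de z : C) : (ga * z + de)%C <> 0%C ->
  cdiff (moebius al be ga de) z
    ((al * de - be * ga) / ((ga * z + de) * (ga * z + de)))%C.
Proof.
  intros Hz eps Heps.
  assert (Hn : 0 < Cmod (ga * z + de)%C) by (apply Cmod_gt_0; exact Hz).
  set (n := Cmod (ga * z + de)%C) in *.
  pose proof (Cmod_ge_0 ga) as Hga.
  set (k := Cmod (ga * (al * de - be * ga))%C).
  assert (Hk : 0 <= k) by apply Cmod_ge_0.
  exists (Rmin (n / (2 * (1 + Cmod ga))) (eps * (n * n * n) / (2 * (1 + k)))).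
  assert (Hn3 : 0 < n * n * n) by (repeat apply Rmult_lt_0_compat; assumption).
  split. { apply Rmin_pos. apply Rdiv_lt_0_compat; lra.
    apply Rdiv_lt_0_compat. apply Rmult_lt_0_compat; lra. lra. }
  intros w Hw.
  assert (W1 := Rlt_le_trans _ _ _ Hw (Rmin_l _ _)).
  assert (W2 := Rlt_le_trans _ _ _ Hw (Rmin_r _ _)).
  pose proof (Cmod_ge_0 (w - z)%C) as Hw0.
  set (D := Cmod (w - z)%C) in *.
  assert (Hgw : n / 2 <= Cmod (ga * w + de)%C).
  { assert (n <= Cmod (ga * w + de)%C + Cmod ga * D).
    { unfold n. replace (ga * z + de)%C with ((ga * w + de) + - (ga * (w - z)))%C by ring.
      eapply Rle_trans. apply Cmod_triangle. rewrite Cmod_opp, Cmod_mult. apply Rle_refl. }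
    apply Rmult_lt_compat_l with (r := 1 + Cmod ga) in W1; [|lra].
    replace ((1 + Cmod ga) * (n / (2 * (1 + Cmod ga)))) with (n / 2) in W1 by (field; lra).
    nra. }
  assert (Hw' : (ga * w + de)%C <> 0%C).
  { intros E. rewrite E, Cmod_0 in Hgw. lra. }
  unfold moebius.
  replace ((al * w + be) / (ga * w + de) - (al * z + be) / (ga * z + de)
    - (al * de - be * ga) / ((ga * z + de) * (ga * z + de)) * (w - z))%C with
    (- ((ga * (al * de - be * ga)) * (w - z) * (w - z) / ((ga * w + de) * (ga * z + de) * (ga * z + de))))%C
    by (field; split; assumption).
  rewrite Cmod_opp, Cmod_div by (repeat apply Cmult_neq_0; assumption).
  rewrite (Cmod_mult _ (w - z)), (Cmod_mult _ (w - z)).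
  rewrite (Cmod_mult (_ * _) (ga * z + de)), (Cmod_mult (ga * w + de)).
  fold n D k.
  set (m := Cmod (ga * w + de)%C) in *.
  assert (Hm : 0 < m * n * n). { repeat apply Rmult_lt_0_compat; lra. }
  apply Rmult_le_reg_r with (m * n * n). exact Hm.
  replace (k * D * D / (m * n * n) * (m * n * n)) with (k * D * D) by (field; repeat split; lra).
  apply Rmult_lt_compat_l with (r := 1 + k) in W2; [|lra].
  replace ((1 + k) * (eps * (n * n * n) / (2 * (1 + k)))) with (eps * (n * n * n) / 2) in W2 by (field; lra).
  assert (k * D <= eps * (m * n * n)).
  { apply Rle_trans with (eps * (n * n * n) / 2). nra.
    assert (n / 2 * (n * n) <= m * (n * n)) by (apply Rmult_le_compat_r; nra).
    assert (eps * (n / 2 * (n * n)) <= eps * (m * (n * n))) by (apply Rmult_le_compat_l; lra).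
    lra. }
  replace (eps * D * (m * n * n)) with (eps * (m * n * n) * D) by ring.
  apply Rmult_le_compat_r; assumption.
Qed.

(** * Goursat's lemma for real differential forms *)

Lemma nested_intervals (u v : nat -> R) :
  (forall n, u n <= u (S n)) -> (forall n, v (S n) <= v n) -> (forall n, u n <= v n) ->
  exists p, forall n, u n <= p <= v n.
Proof.
  intros Hu Hv Huv.
  assert (Mu : forall n k, u n <= u (n + k)%nat).
  { intros n k; induction k as [|k IH]; [rewrite Nat.add_0_r; lra|].
    rewrite Nat.add_succ_r. specialize (Hu (n + k)%nat). lra. }
  assert (Mv : forall n k, v (n + k)%nat <= v n).
  { intros n k; induction k as [|k IH]; [rewrite Nat.add_0_r; lra|].
    rewrite Nat.add_succ_r. specialize (Hv (n + k)%nat). lra. }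
  assert (Hub : forall n m, u m <= v n).
  { intros n m. specialize (Mu m n). specialize (Mv n m). specialize (Huv (m + n)%nat).
    rewrite (Nat.add_comm n m) in Mv. lra. }
  destruct (completeness (fun r => exists n, r = u n)) as [p [Hp1 Hp2]].
  - exists (v 0%nat). intros r [n ->]. apply Hub.
  - exists (u 0%nat), 0%nat. reflexivity.
  - exists p. intros n. split.
    + apply Hp1. exists n. reflexivity.
    + apply Hp2. intros r [m ->]. apply Hub.
Qed.

(** Cousin's principle in the plane, for the halving used in Goursat's proof: a property inherited
from the four quarters and true of all small rectangles around each point holds of the whole
rectangle. If it failed, one would pick a bad quarter again and again; the nested bad rectangles
shrink to a point, where the local hypothesis is contradicted. *)
Lemma rectangle_bisection (P : R -> R -> R -> R -> Prop) (a b c d : R) :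
  a <= b -> c <= d ->
  (forall x1 x2 y1 y2, a <= x1 -> x1 <= x2 -> x2 <= b -> c <= y1 -> y1 <= y2 -> y2 <= d ->
     let xm := (x1 + x2) / 2 in let ym := (y1 + y2) / 2 in
     P x1 xm y1 ym -> P xm x2 y1 ym -> P x1 xm ym y2 -> P xm x2 ym y2 ->
     P x1 x2 y1 y2) ->
  (forall p q, a <= p <= b -> c <= q <= d -> exists delta, 0 < delta /\
     forall x1 x2 y1 y2, a <= x1 -> x1 <= p <= x2 -> x2 <= b ->
       c <= y1 -> y1 <= q <= y2 -> y2 <= d ->
       (x2 - x1) + (y2 - y1) < delta -> P x1 x2 y1 y2) ->
  P a b c d.
Proof.
  intros Hab Hcd Hsplit Hloc.
  apply NNPP. intros HP.
  set (w := fun n => (b - a) / 2 ^ n). set (h := fun n => (d - c) / 2 ^ n).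
  assert (H2 : forall n, 0 < 2 ^ n) by (intros; apply pow_lt; lra).
  assert (Hw : forall n, w n = 2 * w (S n)).
  { intros n. unfold w. simpl. field. specialize (H2 n). lra. }
  assert (Hh : forall n, h n = 2 * h (S n)).
  { intros n. unfold h. simpl. field. specialize (H2 n). lra. }
  assert (Hw0 : forall n, 0 <= w n).
  { intros n. unfold w. apply Rmult_le_pos; [lra|]. left. apply Rinv_0_lt_compat, H2. }
  assert (Hh0 : forall n, 0 <= h n).
  { intros n. unfold h. apply Rmult_le_pos; [lra|]. left. apply Rinv_0_lt_compat, H2. }
  set (Q := fun n (p : R * R) =>
    a <= fst p /\ fst p + w n <= b /\ c <= snd p /\ snd p + h n <= d /\
    ~ P (fst p) (fst p + w n) (snd p) (snd p + h n)).
  assert (Hstep : forall n p, exists p', Q n p ->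
    Q (S n) p' /\ fst p <= fst p' /\ fst p' + w (S n) <= fst p + w n /\
    snd p <= snd p' /\ snd p' + h (S n) <= snd p + h n).
  { intros n [x y].
    destruct (classic (Q n (x, y))) as [HQ|HQ]; [|exists (x, y); tauto].
    destruct HQ as (Q1 & Q2 & Q3 & Q4 & Q5). simpl in *.
    pose proof (Hw n) as Ew. pose proof (Hh n) as Eh.
    pose proof (Hw0 (S n)) as Pw. pose proof (Hh0 (S n)) as Ph.
    assert (Em : (x + (x + w n)) / 2 = x + w (S n)) by lra.
    assert (En : (y + (y + h n)) / 2 = y + h (S n)) by lra.
    assert (Em' : x + w n = x + w (S n) + w (S n)) by lra.
    assert (En' : y + h n = y + h (S n) + h (S n)) by lra.
    (* one of the four quarters is bad, since otherwise the rectangle would be good *)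
    specialize (Hsplit x (x + w n) y (y + h n) ltac:(lra) ltac:(lra) ltac:(lra)
      ltac:(lra) ltac:(lra) ltac:(lra)).
    simpl in Hsplit. rewrite Em, En in Hsplit.
    destruct (classic (P x (x + w (S n)) y (y + h (S n)))) as [R1|R1];
      [|exists (x, y); intros _; unfold Q; simpl; repeat split; try assumption; lra].
    destruct (classic (P (x + w (S n)) (x + w n) y (y + h (S n)))) as [R2|R2];
      [|exists (x + w (S n), y); intros _; unfold Q; simpl; rewrite <- Em'; repeat split; try assumption; lra].
    destruct (classic (P x (x + w (S n)) (y + h (S n)) (y + h n))) as [R3|R3];
      [|exists (x, y + h (S n)); intros _; unfold Q; simpl; rewrite <- En'; repeat split; try assumption; lra].
    destruct (classic (P (x + w (S n)) (x + w n) (y + h (S n)) (y + h n))) as [R4|R4];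
      [|exists (x + w (S n), y + h (S n)); intros _; unfold Q; simpl; rewrite <- En', <- Em'; repeat split; try assumption; lra].
    tauto. }
  set (next := fun n p => proj1_sig (constructive_indefinite_description _ (Hstep n p))).
  assert (Hnext := fun n p => proj2_sig (constructive_indefinite_description _ (Hstep n p))).
  set (u := fix u n := match n with O => (a, c) | S k => next k (u k) end).
  assert (HQ : forall n, Q n (u n)).
  { induction n as [|n IH].
    - unfold Q, w, h. simpl. replace (a + (b - a) / 1) with b by field.
      replace (c + (d - c) / 1) with d by field. repeat split; try assumption; lra.
    - apply (Hnext n (u n)). exact IH. }
  assert (HN : forall n, fst (u n) <= fst (u (S n)) /\ fst (u (S n)) + w (S n) <= fst (u n) + w n /\
    snd (u n) <= snd (u (S n)) /\ snd (u (S n)) + h (S n) <= snd (u n) + h n).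
  { intros n. apply (Hnext n (u n)). apply HQ. }
  destruct (nested_intervals (fun n => fst (u n)) (fun n => fst (u n) + w n)) as [p Hp].
  { intros n; apply HN. } { intros n; apply HN. } { intros n; specialize (Hw0 n); lra. }
  destruct (nested_intervals (fun n => snd (u n)) (fun n => snd (u n) + h n)) as [q Hq].
  { intros n; apply HN. } { intros n; apply HN. } { intros n; specialize (Hh0 n); lra. }
  simpl in Hp, Hq.
  assert (Bp := Hp 0%nat). assert (Bq := Hq 0%nat).
  destruct (HQ 0%nat) as (Q1 & Q2 & Q3 & Q4 & _).
  destruct (Hloc p q) as [delta [Hd HP']]; [lra|lra|].
  assert (exists n, w n + h n < delta) as [n Hn].
  { destruct (pow_lt_1_zero (/ 2)) with (y := delta / (1 + (b - a) + (d - c))) as [n Hn].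
    rewrite Rabs_pos_eq; lra. apply Rdiv_lt_0_compat; lra.
    exists n. specialize (Hn n (Nat.le_refl n)).
    rewrite Rabs_pos_eq in Hn by (apply pow_le; lra).
    unfold w, h. rewrite pow_inv in Hn.
    apply Rmult_lt_compat_l with (r := 1 + (b - a) + (d - c)) in Hn; [|lra].
    replace ((1 + (b - a) + (d - c)) * (delta / (1 + (b - a) + (d - c)))) with delta in Hn by (field; lra).
    assert (0 < / 2 ^ n) by (apply Rinv_0_lt_compat, H2). unfold Rdiv. nra. }
  destruct (HQ n) as (R1 & R2 & R3 & R4 & R5). apply R5. apply HP'; try assumption.
  apply Hp. apply Hq. lra.
Qed.

(** The integral of the form [A dx + B dy] over the boundary of a rectangle, counterclockwise. *)
Definition circulation (A B : R -> R -> R) (x1 x2 y1 y2 : R) : R :=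
  RInt (fun x => A x y1) x1 x2 - RInt (fun x => A x y2) x1 x2
  + RInt (fun y => B x2 y) y1 y2 - RInt (fun y => B x1 y) y1 y2.

(** Both coefficients are differentiable at the point, and the shared slope [m] expresses that
the y-derivative of [A] equals the x-derivative of [B]. Nothing is said of the continuity of these
derivatives, which is the whole point of Goursat's lemma. *)
Definition closed_form_at (A B : R -> R -> R) (p q : R) : Prop :=
  exists l m k, forall eps, 0 < eps -> exists delta, 0 < delta /\
    forall x y, Rabs (x - p) < delta -> Rabs (y - q) < delta ->
      Rabs (A x y - A p q - l * (x - p) - m * (y - q)) <= eps * (Rabs (x - p) + Rabs (y - q)) /\
      Rabs (B x y - B p q - m * (x - p) - k * (y - q)) <= eps * (Rabs (x - p) + Rabs (y - q)).

Lemma continuous_of_lip (f : R -> R) (p K delta : R) :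
  0 < delta -> (forall x, Rabs (x - p) < delta -> Rabs (f x - f p) <= K * Rabs (x - p)) ->
  continuous f p.
Proof.
  intros Hd H. apply continuity_pt_filterlim. 
  intros eps Heps.
  assert (HK : 0 < 1 + Rabs K) by (pose proof (Rabs_pos K); lra).
  exists (Rmin delta (eps / (1 + Rabs K))). split.
  { apply Rmin_pos. exact Hd. apply Rdiv_lt_0_compat; lra. }
  intros x [_ Hx]. simpl in *. unfold R_dist in *.
  assert (W1 := Rlt_le_trans _ _ _ Hx (Rmin_l _ _)).
  assert (W2 := Rlt_le_trans _ _ _ Hx (Rmin_r _ _)).
  specialize (H x W1). apply Rmult_lt_compat_l with (r := 1 + Rabs K) in W2; [|lra].
  replace ((1 + Rabs K) * (eps / (1 + Rabs K))) with eps in W2 by (field; lra).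
  pose proof (Rle_abs K). pose proof (Rabs_pos (x - p)). nra.
Qed.

Lemma closed_form_continuous (A B : R -> R -> R) (p q : R) : closed_form_at A B p q ->
  continuous (fun x => A x q) p /\ continuous (fun y => B p y) q.
Proof.
  intros (l & m & k & H). destruct (H 1 Rlt_0_1) as [d [Hd Hf]]. split.
  - apply continuous_of_lip with (K := 1 + Rabs l) (delta := d). exact Hd.
    intros x Hx. destruct (Hf x q Hx) as [H1 _]. rewrite Rminus_diag, Rabs_R0; exact Hd.
    rewrite Rminus_diag, Rabs_R0 in H1.
    replace (A x q - A p q) with ((A x q - A p q - l * (x - p) - m * 0) + l * (x - p)) by ring.
    eapply Rle_trans. apply Rabs_triang. rewrite (Rabs_mult l). lra.
  - apply continuous_of_lip with (K := 1 + Rabs k) (delta := d). exact Hd.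
    intros y Hy. destruct (Hf p y) as [_ H1]. rewrite Rminus_diag, Rabs_R0; exact Hd. exact Hy.
    rewrite Rminus_diag, Rabs_R0 in H1.
    replace (B p y - B p q) with ((B p y - B p q - m * 0 - k * (y - q)) + k * (y - q)) by ring.
    eapply Rle_trans. apply Rabs_triang. rewrite (Rabs_mult k). lra.
Qed.

(** Opposite sides of a small rectangle are integrated together: on them the integrands differ by
an almost constant quantity [M], so that no integral of the linear part is ever computed. *)
Lemma RInt_diff_approx (f g : R -> R) (x1 x2 M e : R) : x1 <= x2 ->
  (forall x, x1 <= x <= x2 -> continuous f x) ->
  (forall x, x1 <= x <= x2 -> continuous g x) ->
  (forall x, x1 <= x <= x2 -> Rabs (f x - g x - M) <= e) ->
  Rabs (RInt f x1 x2 - RInt g x1 x2 - M * (x2 - x1)) <= e * (x2 - x1).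
Proof.
  intros Hx Hf Hg H.
  assert (If : ex_RInt f x1 x2).
  { apply (ex_RInt_continuous (V := R_CompleteNormedModule)). rewrite Rmin_left, Rmax_right by assumption. exact Hf. }
  assert (Ig : ex_RInt g x1 x2).
  { apply (ex_RInt_continuous (V := R_CompleteNormedModule)). rewrite Rmin_left, Rmax_right by assumption. exact Hg. }
  assert (Ic : ex_RInt (fun _ => M) x1 x2) by apply ex_RInt_const.
  assert (Ifg : ex_RInt (fun x => f x - g x) x1 x2) by (apply (ex_RInt_minus f g); assumption).
  assert (E : RInt (fun x => f x - g x - M) x1 x2 = RInt f x1 x2 - RInt g x1 x2 - M * (x2 - x1)).
  { rewrite (RInt_minus (fun x => f x - g x) (fun _ => M)) by assumption.
    rewrite (RInt_minus f g) by assumption. rewrite RInt_const.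
    unfold minus, plus, opp, scal; simpl. unfold mult; simpl. ring. }
  rewrite <- E, Rmult_comm. apply abs_RInt_le_const; [assumption| |assumption].
  apply (ex_RInt_minus (fun x => f x - g x) (fun _ => M)); assumption.
Qed.

(** The circulation is additive under quartering and, by differentiability, it is at most [e] times
the squared half-perimeter on small rectangles around any point: the contributions [- m] and [+ m] of
the two pairs of sides cancel. Bisection extends the bound to the full rectangle for each [e > 0]. *)
Lemma goursat (A B : R -> R -> R) (a b c d : R) : a <= b -> c <= d ->
  (forall p q, a <= p <= b -> c <= q <= d -> closed_form_at A B p q) ->
  circulation A B a b c d = 0.
Proof.
  intros Hab Hcd H.
  assert (CA : forall x y, a <= x <= b -> c <= y <= d -> continuous (fun x => A x y) x).
  { intros x y Hx Hy. apply (closed_form_continuous A B), H; assumption. }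
  assert (CB : forall x y, a <= x <= b -> c <= y <= d -> continuous (fun y => B x y) y).
  { intros x y Hx Hy. apply (closed_form_continuous A B), H; assumption. }
  assert (IA : forall x1 x2 y, a <= x1 -> x1 <= x2 -> x2 <= b -> c <= y <= d -> ex_RInt (fun x => A x y) x1 x2).
  { intros. apply (ex_RInt_continuous (V := R_CompleteNormedModule)).
    rewrite Rmin_left, Rmax_right by assumption. intros. apply CA; lra. }
  assert (IB : forall x y1 y2, c <= y1 -> y1 <= y2 -> y2 <= d -> a <= x <= b -> ex_RInt (fun y => B x y) y1 y2).
  { intros. apply (ex_RInt_continuous (V := R_CompleteNormedModule)).
    rewrite Rmin_left, Rmax_right by assumption. intros. apply CB; lra. }
  assert (Hall : forall e, 0 < e -> Rabs (circulation A B a b c d) <= e * ((b - a) + (d - c)) ^ 2).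
  { intros e He.
    apply (rectangle_bisection (fun x1 x2 y1 y2 =>
      Rabs (circulation A B x1 x2 y1 y2) <= e * ((x2 - x1) + (y2 - y1)) ^ 2)); try assumption.
    - intros x1 x2 y1 y2 X1 X2 X3 Y1 Y2 Y3 xm ym P1 P2 P3 P4.
      assert (Hxm : x1 <= xm <= x2) by (unfold xm; lra).
      assert (Hym : y1 <= ym <= y2) by (unfold ym; lra).
      assert (E : circulation A B x1 x2 y1 y2 = circulation A B x1 xm y1 ym
        + circulation A B xm x2 y1 ym + circulation A B x1 xm ym y2 + circulation A B xm x2 ym y2).
      { assert (EA : forall y, c <= y <= d -> RInt (fun x => A x y) x1 x2 =
          RInt (fun x => A x y) x1 xm + RInt (fun x => A x y) xm x2).
        { intros y Hy. symmetry. apply (RInt_Chasles (fun x => A x y)); apply IA; lra. }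
        assert (EB : forall x, a <= x <= b -> RInt (fun y => B x y) y1 y2 =
          RInt (fun y => B x y) y1 ym + RInt (fun y => B x y) ym y2).
        { intros x Hx. symmetry. apply (RInt_Chasles (fun y => B x y)); apply IB; lra. }
        unfold circulation. rewrite !EA, !EB by lra. ring. }
      rewrite E.
      set (s := (x2 - x1) + (y2 - y1)).
      replace (xm - x1 + (ym - y1)) with (s / 2) in P1 by (unfold s, xm, ym; field).
      replace (x2 - xm + (ym - y1)) with (s / 2) in P2 by (unfold s, xm, ym; field).
      replace (xm - x1 + (y2 - ym)) with (s / 2) in P3 by (unfold s, xm, ym; field).
      replace (x2 - xm + (y2 - ym)) with (s / 2) in P4 by (unfold s, xm, ym; field).
      apply Rabs_le_between in P1; apply Rabs_le_between in P2; apply Rabs_le_between in P3; apply Rabs_le_between in P4.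
      apply Rabs_le. lra.
    - intros p q Hp Hq.
      destruct (H p q Hp Hq) as (l & m & k & HD).
      destruct (HD (e / 2)) as [delta [Hd Hf]]; [lra|].
      exists delta. split; [exact Hd|].
      intros x1 x2 y1 y2 X1 X2 X3 Y1 Y2 Y3 Hs.
      set (s := (x2 - x1) + (y2 - y1)) in *.
      assert (Hf' : forall x y, x1 <= x <= x2 -> y1 <= y <= y2 ->
        Rabs (A x y - A p q - l * (x - p) - m * (y - q)) <= e / 2 * s /\
        Rabs (B x y - B p q - m * (x - p) - k * (y - q)) <= e / 2 * s).
      { intros x y Hx Hy.
        assert (Ax : Rabs (x - p) <= x2 - x1) by (apply Rabs_le; lra).
        assert (Ay : Rabs (y - q) <= y2 - y1) by (apply Rabs_le; lra).
        destruct (Hf x y) as [F1 F2]; try (unfold s in *; lra).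
        assert (e / 2 * (Rabs (x - p) + Rabs (y - q)) <= e / 2 * s) by (apply Rmult_le_compat_l; unfold s; lra).
        lra. }
      assert (HA : Rabs (RInt (fun x => A x y1) x1 x2 - RInt (fun x => A x y2) x1 x2 - (- m * (y2 - y1)) * (x2 - x1))
        <= e * s * (x2 - x1)).
      { apply RInt_diff_approx; try (intros; apply CA); try lra.
        intros x Hx. destruct (Hf' x y1 Hx) as [F1 _]; [lra|]. destruct (Hf' x y2 Hx) as [F2 _]; [lra|].
        apply Rabs_le_between in F1; apply Rabs_le_between in F2. apply Rabs_le. lra. }
      assert (HB : Rabs (RInt (fun y => B x2 y) y1 y2 - RInt (fun y => B x1 y) y1 y2 - (m * (x2 - x1)) * (y2 - y1))
        <= e * s * (y2 - y1)).
      { apply RInt_diff_approx; try (intros; apply CB); try lra.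
        intros y Hy. destruct (Hf' x1 y) as [_ F1]; [lra|lra|]. destruct (Hf' x2 y) as [_ F2]; [lra|lra|].
        apply Rabs_le_between in F1; apply Rabs_le_between in F2. apply Rabs_le. lra. }
      apply Rabs_le_between in HA; apply Rabs_le_between in HB.
      replace (e * s ^ 2) with (e * s * (x2 - x1) + e * s * (y2 - y1)) by (unfold s; ring).
      unfold circulation. apply Rabs_le. lra. }
  destruct (Req_dec (circulation A B a b c d) 0) as [|Hn]; [assumption|exfalso].
  assert (Hpos := Rabs_pos_lt _ Hn).
  set (S2 := ((b - a) + (d - c)) ^ 2) in *.
  assert (HS : 0 <= S2) by (unfold S2; nra).
  specialize (Hall (Rabs (circulation A B a b c d) / (2 * (1 + S2)))).
  assert (HJ : 0 < Rabs (circulation A B a b c d) / (2 * (1 + S2))) by (apply Rdiv_lt_0_compat; lra).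
  specialize (Hall HJ).
  assert (HE : Rabs (circulation A B a b c d) / (2 * (1 + S2)) * (1 + S2) = Rabs (circulation A B a b c d) / 2) by (field; lra).
  lra.
Qed.

(** * The Schwarz lemma for the derivative at the fixed point *)

Lemma Cmod_le_Rabs (z : C) : Cmod z <= Rabs (Re z) + Rabs (Im z).
Proof.
  destruct z as [x y]. simpl.
  replace (x, y) with (RtoC x + (0, y))%C by (unfold RtoC, Cplus; simpl; f_equal; ring).
  eapply Rle_trans. apply Cmod_triangle. rewrite Cmod_R.
  apply Rplus_le_compat_l. unfold Cmod; simpl.
  replace (0 * (0 * 1) + y * (y * 1)) with (Rsqr y) by (unfold Rsqr; ring).
  rewrite sqrt_Rsqr_abs. lra.
Qed.

Lemma Rabs_Re_le (z : C) : Rabs (Re z) <= Cmod z.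
Proof. eapply Rle_trans; [apply Rmax_l|apply Rmax_Cmod]. Qed.

Lemma Rabs_Im_le (z : C) : Rabs (Im z) <= Cmod z.
Proof. eapply Rle_trans; [apply Rmax_r|apply Rmax_Cmod]. Qed.

Definition cexp (w : C) : C := (exp (Re w) * cos (Im w), exp (Re w) * sin (Im w)).

Lemma cexp_plus (z w : C) : cexp (z + w)%C = (cexp z * cexp w)%C.
Proof.
  destruct z as [x y], w as [u v]. unfold cexp, Cmult. simpl.
  rewrite exp_plus, cos_plus, sin_plus. f_equal; ring.
Qed.

Lemma Cmod_cexp (w : C) : Cmod (cexp w) = exp (Re w).
Proof.
  unfold Cmod, cexp. simpl.
  replace (_ + _) with (Rsqr (exp (Re w)) * (Rsqr (sin (Im w)) + Rsqr (cos (Im w)))) by (unfold Rsqr; ring).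
  rewrite sin2_cos2, Rmult_1_r. apply sqrt_Rsqr. left; apply exp_pos.
Qed.

Lemma derivable_pt_lim_approx (f : R -> R) (p l eps : R) : derivable_pt_lim f p l -> 0 < eps ->
  exists d, 0 < d /\ forall h, Rabs h < d -> Rabs (f (p + h) - f p - l * h) <= eps * Rabs h.
Proof.
  intros H He. destruct (H eps He) as [d Hd]. exists d. split; [apply cond_pos|].
  intros h Hh. destruct (Req_dec h 0) as [->|Hn].
  - rewrite Rplus_0_r. replace (f p - f p - l * 0) with 0 by ring. rewrite Rabs_R0. lra.
  - specialize (Hd h Hn Hh).
    replace (f (p + h) - f p - l * h) with (((f (p + h) - f p) / h - l) * h) by (field; exact Hn).
    rewrite Rabs_mult. apply Rmult_le_compat_r. apply Rabs_pos. lra.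
Qed.

Lemma cdiff_cexp (z : C) : cdiff cexp z (cexp z).
Proof.
  intros eps Heps.
  set (k := Cmod (cexp z)). assert (Hk : 0 <= k) by apply Cmod_ge_0.
  set (e := Rmin 1 (eps / (9 * (1 + k)))).
  assert (He : 0 < e) by (apply Rmin_pos; [lra|apply Rdiv_lt_0_compat; lra]).
  assert (He1 : e <= 1) by apply Rmin_l.
  assert (He2 : 9 * e * (1 + k) <= eps).
  { apply Rle_trans with (9 * (eps / (9 * (1 + k))) * (1 + k)).
    - apply Rmult_le_compat_r; [lra|]. apply Rmult_le_compat_l; [lra|]. apply Rmin_r.
    - right. field. lra. }
  clearbody e.
  destruct (derivable_pt_lim_approx exp 0 (exp 0) e (derivable_pt_lim_exp 0) He) as [d1 [Hd1 D1]].
  destruct (derivable_pt_lim_approx cos 0 (- sin 0) e (derivable_pt_lim_cos 0) He) as [d2 [Hd2 D2]].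
  destruct (derivable_pt_lim_approx sin 0 (cos 0) e (derivable_pt_lim_sin 0) He) as [d3 [Hd3 D3]].
  rewrite exp_0 in D1. rewrite sin_0, cos_0 in D2, D3.
  exists (Rmin (Rmin d1 d2) (Rmin d3 e)). split. repeat apply Rmin_pos; assumption.
  intros w Hw.
  replace (cexp w - cexp z - cexp z * (w - z))%C with (cexp z * (cexp (w - z) - 1 - (w - z)))%C.
  2:{ replace (cexp w) with (cexp z * cexp (w - z))%C. ring.
      rewrite <- cexp_plus. f_equal. ring. }
  assert (W12 := Rlt_le_trans _ _ _ Hw (Rmin_l _ _)).
  assert (W34 := Rlt_le_trans _ _ _ Hw (Rmin_r _ _)).
  assert (W1 := Rlt_le_trans _ _ _ W12 (Rmin_l _ _)).
  assert (W2 := Rlt_le_trans _ _ _ W12 (Rmin_r _ _)).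
  assert (W3 := Rlt_le_trans _ _ _ W34 (Rmin_l _ _)).
  assert (W4 := Rlt_le_trans _ _ _ W34 (Rmin_r _ _)).
  set (h := (w - z)%C) in *. clearbody h.
  pose proof (Rabs_Re_le h) as Hx. pose proof (Rabs_Im_le h) as Hy.
  set (D := Cmod h) in *. clearbody D.
  rewrite Cmod_mult. fold k.
  specialize (D1 (Re h) ltac:(lra)). specialize (D2 (Im h) ltac:(lra)). specialize (D3 (Im h) ltac:(lra)).
  rewrite Rplus_0_l in D1, D2, D3.
  rewrite Rmult_1_l in D1. rewrite Rmult_1_l in D3.
  replace (cos (Im h) - 1 - - 0 * Im h) with (cos (Im h) - 1) in D2 by ring.
  rewrite Rminus_0_r in D3.
  assert (Hb : Cmod (cexp h - 1 - h)%C <= 9 * e * D).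
  { eapply Rle_trans. apply Cmod_le_Rabs.
    destruct h as [x y]. simpl in *.
    set (ex := exp x) in *. set (cy := cos y) in *. set (sy := sin y) in *.
    pose proof (Rabs_pos x). pose proof (Rabs_pos y).
    assert (Ee : Rabs (ex - 1) <= 2 * Rabs x).
    { replace (ex - 1) with ((ex - 1 - x) + x) by ring. eapply Rle_trans. apply Rabs_triang. nra. }
    assert (Ex : Rabs ex <= 3).
    { replace ex with ((ex - 1) + 1) by ring. eapply Rle_trans. apply Rabs_triang. rewrite Rabs_R1. lra. }
    replace (ex * cy + - (1) + - x) with (ex * (cy - 1) + (ex - 1 - x)) by ring.
    replace (ex * sy + - 0 + - y) with (ex * (sy - y) + (ex - 1) * y) by ring.
    assert (T1 : Rabs (ex * (cy - 1) + (ex - 1 - x)) <= 3 * (e * D) + e * D).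
    { eapply Rle_trans. apply Rabs_triang. rewrite Rabs_mult.
      assert (Rabs ex * Rabs (cy - 1) <= 3 * (e * D)).
      { apply Rmult_le_compat; try apply Rabs_pos. exact Ex. nra. }
      nra. }
    assert (T2 : Rabs (ex * (sy - y) + (ex - 1) * y) <= 3 * (e * D) + (2 * e) * D).
    { eapply Rle_trans. apply Rabs_triang. rewrite !Rabs_mult.
      assert (Rabs ex * Rabs (sy - y) <= 3 * (e * D)).
      { apply Rmult_le_compat; try apply Rabs_pos. exact Ex. nra. }
      assert (Rabs (ex - 1) * Rabs y <= (2 * e) * D).
      { apply Rmult_le_compat; try apply Rabs_pos. lra. lra. }
      lra. }
    lra. }
  pose proof (Rabs_pos (Re h)).
  assert (0 <= e * D) by nra.
  apply Rle_trans with (k * (9 * e * D)). apply Rmult_le_compat_l; assumption.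
  assert (9 * e * (1 + k) * D <= eps * D) by (apply Rmult_le_compat_r; lra).
  nra.
Qed.

(** The Cauchy-Riemann equations: [Im F dx + Re F dy] is the imaginary part of [F dw]. *)
Lemma closed_form_of_cdiff (F : C -> C) (p q : R) (l : C) : cdiff F (p, q) l ->
  closed_form_at (fun x y => Im (F (x, y))) (fun x y => Re (F (x, y))) p q.
Proof.
  intros H. exists (Im l), (Re l), (- Im l). intros eps Heps.
  destruct (H (eps) Heps) as [d [Hd Hf]].
  exists (d / 2). split; [lra|]. intros x y Hx Hy.
  assert (Hm : Cmod ((x, y) - (p, q))%C <= Rabs (x - p) + Rabs (y - q)).
  { eapply Rle_trans. apply Cmod_le_Rabs. simpl. unfold Rminus. lra. }
  specialize (Hf (x, y) ltac:(lra)).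
  assert (Hm' : eps * Cmod ((x, y) - (p, q))%C <= eps * (Rabs (x - p) + Rabs (y - q))) by (apply Rmult_le_compat_l; lra).
  split.
  - eapply Rle_trans; [|exact Hm']. eapply Rle_trans; [|exact Hf].
    eapply Rle_trans; [|apply Rabs_Im_le]. right. f_equal.
    unfold Im, Re. simpl. ring.
  - eapply Rle_trans; [|exact Hm']. eapply Rle_trans; [|exact Hf].
    eapply Rle_trans; [|apply Rabs_Re_le]. right. f_equal.
    unfold Im, Re. simpl. ring.
Qed.

(** In the boundary integral of [H] over a rectangle spanning a full period, the two horizontal
sides cancel. *)
Lemma RInt_Re_vertical_period (H : C -> C) (x0 x1 T : R) : x0 <= x1 -> 0 <= T ->
  (forall w, x0 <= Re w <= x1 -> exists l, cdiff H w l) ->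
  (forall x, H (x, T) = H (x, 0)) ->
  RInt (fun y => Re (H (x0, y))) 0 T = RInt (fun y => Re (H (x1, y))) 0 T.
Proof.
  intros Hx HT Hd Hp.
  assert (G := goursat (fun x y => Im (H (x, y))) (fun x y => Re (H (x, y))) x0 x1 0 T Hx HT).
  unfold circulation in G.
  rewrite (RInt_ext (fun x => Im (H (x, T))) (fun x => Im (H (x, 0)))) in G.
  2:{ intros. now rewrite Hp. }
  assert (G' : forall p q : R, x0 <= p <= x1 -> 0 <= q <= T -> closed_form_at (fun x y : R => Im (H (x, y))) (fun x y : R => Re (H (x, y))) p q).
  { intros p q Hpx Hq. destruct (Hd (p, q) Hpx) as [l Hl]. exact (closed_form_of_cdiff H p q l Hl). }
  specialize (G G'). lra.
Qed.

Definition disc_self_map (f : C -> C) : Prop :=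
  (forall z, Disc z -> exists l, cdiff f z l) /\ (forall z, Disc z -> Disc (f z)).

Lemma cexp_neg (w : C) : (cexp w * cexp (- w))%C = 1%C.
Proof.
  rewrite <- cexp_plus. replace (w + - w)%C with (RtoC 0) by ring.
  unfold cexp. simpl. rewrite exp_0, cos_0, sin_0. unfold RtoC. f_equal; ring.
Qed.

(** Polar coordinates without a polar contour: [H w = g (e^w) e^(-w)] is [g z / z] read in
the variable [w = log z], with period [2 pi i]. Its mean over a vertical period is the same for all
[Re w < 0]; it is close to [l] when [Re w] is very negative, and at most [e^(-Re w)] in modulus,
which is close to 1 when [Re w] is close to 0. *)
Lemma schwarz_derivative_Re (g : C -> C) (l : C) : disc_self_map g -> g 0%C = 0%C -> cdiff g 0%C l -> Re l <= 1.
Proof.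
  intros [Hd Hm] H0 Hl.
  destruct (Rle_lt_dec (Re l) 1) as [|Hgt]; [assumption|exfalso].
  set (H := fun w => (g (cexp w) * cexp (- w))%C).
  assert (HD : forall w, Re w < 0 -> Disc (cexp w)).
  { intros w Hw. unfold Disc. rewrite Cmod_cexp, <- exp_0. apply exp_increasing. exact Hw. }
  assert (Hc : forall w, Re w < 0 -> exists m, cdiff H w m).
  { intros w Hw. destruct (Hd (cexp w) (HD w Hw)) as [m Hmm].
    assert (C1 := cdiff_comp g cexp w _ _ (cdiff_cexp w) Hmm).
    assert (N1 : cdiff (fun w => - w)%C w (- (1))%C).
    { intros eps He. exists 1. split; [lra|]. intros v _.
      replace (- v - - w - - (1) * (v - w))%C with (RtoC 0) by ring. rewrite Cmod_0.
      apply Rmult_le_pos; [lra|apply Cmod_ge_0]. }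
    assert (C2 := cdiff_comp cexp (fun w => - w)%C w _ _ N1 (cdiff_cexp (- w)%C)).
    eexists. exact (cdiff_mult _ _ _ _ _ C1 C2). }
  assert (Hper : forall x, H (x, 2 * PI) = H (x, 0)).
  { intros x. unfold H, cexp. simpl. rewrite Ropp_0, cos_neg, sin_neg, cos_2PI, sin_2PI, cos_0, sin_0.
    rewrite Ropp_0. reflexivity. }
  (* chosen so that [exp (- x1)] is the midpoint of 1 and [Re l] *)
  set (x1 := - ln ((1 + Re l) / 2)).
  assert (Hx1 : x1 < 0).
  { unfold x1. assert (0 < ln ((1 + Re l) / 2)); [|lra]. rewrite <- ln_1. apply ln_increasing; lra. }
  destruct (Hl ((Re l - 1) / 4)) as [d [Hdp Hdl]]; [lra|].
  set (x0 := Rmin x1 (ln (d / 2))).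
  assert (Hx0 : x0 <= x1) by apply Rmin_l.
  pose proof PI_RGT_0 as HPI.
  assert (E := RInt_Re_vertical_period H x0 x1 (2 * PI) Hx0 ltac:(lra)
    (fun w Hw => Hc w ltac:(lra)) Hper).
  assert (Hcont : forall x y, x < 0 -> continuous (fun y => Re (H (x, y))) y).
  { intros x y Hx. destruct (Hc (x, y) Hx) as [m Hmm].
    apply (closed_form_continuous _ _ _ _ (closed_form_of_cdiff H x y m Hmm)). }
  assert (HI : forall x, x < 0 -> ex_RInt (fun y => Re (H (x, y))) 0 (2 * PI)).
  { intros x Hx. apply (ex_RInt_continuous (V := R_CompleteNormedModule)). intros y _. apply Hcont, Hx. }
  assert (U : RInt (fun y => Re (H (x1, y))) 0 (2 * PI) <= RInt (fun _ => (1 + Re l) / 2) 0 (2 * PI)).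
  { apply RInt_le; [lra|apply HI; lra|apply ex_RInt_const|].
    intros y _. eapply Rle_trans. apply Rle_abs. eapply Rle_trans. apply Rabs_Re_le.
    unfold H. rewrite Cmod_mult, Cmod_cexp. simpl.
    unfold x1 at 2. rewrite Ropp_involutive, exp_ln by lra.
    assert (Hg : Cmod (g (cexp (x1, y))) < 1) by (apply Hm, HD; exact Hx1).
    assert ((1 + Re l) / 2 > 0) by lra. nra. }
  assert (L : RInt (fun _ => Re l - (Re l - 1) / 4) 0 (2 * PI) <= RInt (fun y => Re (H (x0, y))) 0 (2 * PI)).
  { apply RInt_le; [lra|apply ex_RInt_const|apply HI; lra|].
    intros y _.
    set (z := cexp (x0, y)).
    assert (Hz : Cmod (z - 0)%C < d).
    { replace (z - 0)%C with z by ring. unfold z. rewrite Cmod_cexp. simpl.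
      apply Rle_lt_trans with (exp (ln (d / 2))).
      - destruct (Rle_lt_or_eq_dec _ _ (Rmin_r x1 (ln (d / 2)))) as [Hlt|Heq].
        left. apply exp_increasing. exact Hlt. right. f_equal. exact Heq.
      - rewrite exp_ln; lra. }
    specialize (Hdl z Hz). rewrite H0 in Hdl.
    replace (g z - 0 - l * (z - 0))%C with (g z - l * z)%C in Hdl by ring.
    replace (z - 0)%C with z in Hdl by ring.
    assert (HH : (H (x0, y) - l)%C = ((g z - l * z) * cexp (- (x0, y)))%C).
    { transitivity (g z * cexp (- (x0, y)) - l * (z * cexp (- (x0, y))))%C.
      - unfold z at 2. rewrite cexp_neg. unfold H, z. ring.
      - ring. }
    assert (HB : Cmod (H (x0, y) - l)%C <= (Re l - 1) / 4).
    { rewrite HH, Cmod_mult.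
      apply Rle_trans with ((Re l - 1) / 4 * Cmod z * Cmod (cexp (- (x0, y)))).
      apply Rmult_le_compat_r; [apply Cmod_ge_0|exact Hdl].
      right. rewrite Rmult_assoc, <- Cmod_mult. unfold z. rewrite cexp_neg, Cmod_1. ring. }
    assert (HR := Rle_trans _ _ _ (Rabs_Re_le _) HB).
    apply Rabs_le_between in HR. change (Re (H (x0, y) - l)%C) with (Re (H (x0, y)) + - Re l) in HR. lra. }
  rewrite E in L. assert (UL := Rle_trans _ _ _ L U).
  rewrite !RInt_const in UL. unfold scal in UL; simpl in UL. unfold mult in UL; simpl in UL. nra.
Qed.

(** Rotate [g] so that the derivative becomes nonnegative. *)
Lemma schwarz_derivative (g : C -> C) (l : C) : disc_self_map g -> g 0%C = 0%C -> cdiff g 0%C l -> Cmod l <= 1.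
Proof.
  intros [Hd Hm] H0 Hl.
  destruct (Req_dec (Cmod l) 0) as [E|Hn]; [lra|].
  pose proof (Cmod_ge_0 l) as Hp.
  (* the unit complex number with [k l = |l|] *)
  set (k := (Cconj l / RtoC (Cmod l))%C).
  assert (Hln : RtoC (Cmod l) <> 0%C) by (intros E; injection E; exact Hn).
  assert (Hkl : (k * l)%C = RtoC (Cmod l)).
  { unfold k. transitivity ((l * Cconj l) / RtoC (Cmod l))%C. field; exact Hln.
    rewrite <- Cmod2_conj. unfold Rsqr. simpl. rewrite Rmult_1_r, RtoC_mult. field. exact Hln. }
  assert (Hk : Cmod k = 1).
  { unfold k. rewrite Cmod_div by exact Hln. rewrite Cmod_conj, Cmod_R, Rabs_pos_eq by exact Hp. field. exact Hn. }
  assert (Hck : forall z m, cdiff g z m -> cdiff (fun w => k * g w)%C z (k * m)%C).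
  { intros z m Hg eps He. destruct (Hg eps He) as [d [Hdp Hf]]. exists d. split; [exact Hdp|].
    intros w Hw. specialize (Hf w Hw).
    replace (k * g w - k * g z - k * m * (w - z))%C with (k * (g w - g z - m * (w - z)))%C by ring.
    rewrite Cmod_mult, Hk, Rmult_1_l. exact Hf. }
  replace (Cmod l) with (Re (k * l)%C) by (rewrite Hkl; reflexivity).
  apply (schwarz_derivative_Re (fun w => k * g w)%C).
  - split.
    + intros z Hz. destruct (Hd z Hz) as [m Hg]. exists (k * m)%C. apply Hck, Hg.
    + intros z Hz. unfold Disc. rewrite Cmod_mult, Hk, Rmult_1_l. apply Hm, Hz.
  - rewrite H0. ring.
  - apply Hck, Hl.
Qed.

(** * Automorphisms of the disc and the Schwarz-Pick lemma *)

Lemma is_derive_of_approx (f : R -> R) (t l K : R) : 0 <= K ->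
  (forall eps, 0 < eps -> exists d, 0 < d /\ forall s, Rabs (s - t) < d ->
     Rabs (f s - f t - l * (s - t)) <= K * eps * Rabs (s - t)) ->
  is_derive f t l.
Proof.
  intros HK H. apply is_derive_Reals. intros eps Heps.
  set (e := eps / (2 * (1 + K))).
  assert (He : 0 < e) by (apply Rdiv_lt_0_compat; lra).
  assert (HKe : K * e < eps).
  { assert (e * (1 + K) = eps / 2) by (unfold e; field; lra). lra. }
  destruct (H e He) as [d [Hd Hf]].
  exists (mkposreal d Hd). intros h Hn Hh. simpl in Hh.
  specialize (Hf (t + h)). replace (t + h - t) with h in Hf by ring. specialize (Hf Hh).
  replace ((f (t + h) - f t) / h - l) with ((f (t + h) - f t - l * h) / h) by (field; exact Hn).
  unfold Rdiv. rewrite Rabs_mult, Rabs_inv.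
  apply Rmult_lt_reg_r with (Rabs h). apply Rabs_pos_lt; exact Hn.
  assert (0 < Rabs h) by (apply Rabs_pos_lt; exact Hn).
  rewrite Rmult_assoc, Rinv_l, Rmult_1_r by lra.
  eapply Rle_lt_trans. exact Hf. apply Rmult_lt_compat_r; lra.
Qed.

Lemma is_derive_Re_line (f : C -> C) (p e k l : C) (t : R) : cdiff f (p + t * e)%C l ->
  is_derive (fun s : R => Re (k * f (p + s * e))%C) t (Re (k * (l * e))%C).
Proof.
  intros H. apply is_derive_of_approx with (K := Cmod k * Cmod e).
  { apply Rmult_le_pos; apply Cmod_ge_0. }
  intros eps Heps. destruct (H eps Heps) as [d [Hd Hf]].
  assert (He : 0 <= Cmod e) by apply Cmod_ge_0.
  assert (Hd' : 0 < d / (1 + Cmod e)) by (apply Rdiv_lt_0_compat; lra).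
  exists (d / (1 + Cmod e)). split; [exact Hd'|].
  intros s Hs.
  assert (Ew : (p + s * e - (p + t * e))%C = (RtoC (s - t) * e)%C) by (rewrite RtoC_minus; ring).
  assert (Hw : Cmod (p + s * e - (p + t * e))%C = Rabs (s - t) * Cmod e).
  { rewrite Ew, Cmod_mult, Cmod_R. reflexivity. }
  specialize (Hf (p + s * e)%C). rewrite Hw in Hf.
  assert (Hlt : Rabs (s - t) * Cmod e < d).
  { apply Rmult_lt_compat_l with (r := 1 + Cmod e) in Hs; [|lra].
    replace ((1 + Cmod e) * (d / (1 + Cmod e))) with d in Hs by (field; lra).
    pose proof (Rabs_pos (s - t)). nra. }
  specialize (Hf Hlt). rewrite Ew in Hf.
  replace (Re (k * f (p + s * e))%C - Re (k * f (p + t * e))%C - Re (k * (l * e))%C * (s - t))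
    with (Re (k * (f (p + s * e) - f (p + t * e) - l * (RtoC (s - t) * e)))%C).
  2:{ unfold Re, Im; simpl. unfold Re, Im; simpl. ring. }
  eapply Rle_trans. apply Rabs_Re_le. rewrite Cmod_mult.
  eapply Rle_trans. apply Rmult_le_compat_l. apply Cmod_ge_0. exact Hf.
  right. ring.
Qed.

(** The automorphism [z |-> (z + c) / (1 + conj c z)] of the disc, which carries 0 to [c] and whose
inverse is [disc_aut (- c)]. *)
Definition disc_aut (c : C) : C -> C := moebius 1 c (Cconj c) 1.

Lemma Cmod_sq_lt1 (z : C) : Disc z -> 0 < 1 - Cmod z ^ 2.
Proof. unfold Disc. intros H. pose proof (Cmod_ge_0 z). nra. Qed.

Lemma Disc_of_sq (z : C) : 0 < 1 - Cmod z ^ 2 -> Disc z.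
Proof. unfold Disc. intros H. pose proof (Cmod_ge_0 z). nra. Qed.

Lemma Disc_opp (z : C) : Disc z -> Disc (- z)%C.
Proof. unfold Disc. now rewrite Cmod_opp. Qed.

Lemma Disc_0 : Disc 0%C.
Proof. unfold Disc. rewrite Cmod_0. lra. Qed.

Lemma disc_aut_den (c z : C) : Disc c -> Disc z -> (Cconj c * z + 1)%C <> 0%C.
Proof.
  intros Hc Hz E.
  assert (E' : (Cconj c * z)%C = (- (1))%C).
  { replace (Cconj c * z)%C with ((Cconj c * z + 1) - 1)%C by ring. rewrite E. ring. }
  assert (M : Cmod (Cconj c * z)%C = 1) by (rewrite E', Cmod_opp, Cmod_1; reflexivity).
  rewrite Cmod_mult, Cmod_conj in M. unfold Disc in *.
  pose proof (Cmod_ge_0 c). pose proof (Cmod_ge_0 z). nra.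
Qed.

Lemma disc_aut_sq (c z : C) : Disc c -> Disc z ->
  1 - Cmod (disc_aut c z) ^ 2 = (1 - Cmod c ^ 2) * (1 - Cmod z ^ 2) / Cmod (Cconj c * z + 1)%C ^ 2.
Proof.
  intros Hc Hz. assert (Hn := disc_aut_den c z Hc Hz).
  unfold disc_aut, moebius. rewrite Cmod_div by exact Hn.
  assert (Hp : Cmod (Cconj c * z + 1)%C <> 0) by (intros E; apply Hn, Cmod_eq_0, E).
  transitivity ((Cmod (Cconj c * z + 1)%C ^ 2 - Cmod (1 * z + c)%C ^ 2) / Cmod (Cconj c * z + 1)%C ^ 2).
  { field. exact Hp. }
  f_equal. rewrite !Cmod2_alt. destruct c, z. simpl. ring.
Qed.

Lemma disc_aut_disc (c z : C) : Disc c -> Disc z -> Disc (disc_aut c z).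
Proof.
  intros Hc Hz. apply Disc_of_sq. rewrite disc_aut_sq by assumption.
  assert (Hp : 0 < Cmod (Cconj c * z + 1)%C) by (apply Cmod_gt_0, disc_aut_den; assumption).
  apply Rdiv_lt_0_compat. apply Rmult_lt_0_compat; apply Cmod_sq_lt1; assumption.
  apply pow_lt; exact Hp.
Qed.

Lemma disc_aut_0 (c : C) : disc_aut c 0%C = c.
Proof. unfold disc_aut, moebius. field. Qed.

Lemma disc_aut_opp_self (c : C) : Disc c -> disc_aut (- c)%C c = 0%C.
Proof.
  intros H. unfold disc_aut, moebius. assert (Hn := disc_aut_den (- c)%C c (Disc_opp c H) H).
  field. exact Hn.
Qed.

Lemma disc_aut_cancel (c z : C) : Disc c -> Disc z -> disc_aut c (disc_aut (- c)%C z) = z.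
Proof.
  intros Hc Hz. assert (Hn := disc_aut_den (- c)%C z (Disc_opp c Hc) Hz).
  assert (Hm := disc_aut_den c (disc_aut (- c)%C z) Hc (disc_aut_disc _ _ (Disc_opp c Hc) Hz)).
  unfold disc_aut, moebius in *. rewrite Copp_conj in *.
  assert (Hk : (1 - Cconj c * c)%C <> 0%C).
  { intros E. apply (disc_aut_den (- c)%C c (Disc_opp c Hc) Hc). rewrite Copp_conj. rewrite <- E. ring. }
  field. split; [exact Hn|].
  intros E. apply Hk. rewrite <- E. ring.
Qed.

Lemma disc_aut_sub (c z w : C) : Disc c -> Disc z -> Disc w ->
  (disc_aut c z - disc_aut c w)%C =
  ((z - w) * (1 - Cconj c * c) / ((Cconj c * z + 1) * (Cconj c * w + 1)))%C.
Proof.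
  intros Hc Hz Hw. assert (H1 := disc_aut_den c z Hc Hz). assert (H2 := disc_aut_den c w Hc Hw).
  unfold disc_aut, moebius. field. split; assumption.
Qed.

Lemma RtoC_Cmod_sq (c : C) : (1 - Cconj c * c)%C = RtoC (1 - Cmod c ^ 2).
Proof. rewrite Cmod2_alt. destruct c as [x y]. unfold Cconj, Cmult, Cminus, Cplus, Copp, RtoC; simpl. f_equal; ring. Qed.

(** The square of the hyperbolic sine of the Poincare distance: a rational function of the points
that carries the same information. *)
Definition sinh2_dist (p q : C) : R :=
  Cmod (p - q)%C ^ 2 / ((1 - Cmod p ^ 2) * (1 - Cmod q ^ 2)).

Lemma sinh2_dist_disc_aut (c p q : C) : Disc c -> Disc p -> Disc q ->
  sinh2_dist (disc_aut c p) (disc_aut c q) = sinh2_dist p q.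
Proof.
  intros Hc Hp Hq. unfold sinh2_dist.
  rewrite !disc_aut_sq by assumption. rewrite disc_aut_sub by assumption.
  assert (H1 := disc_aut_den c p Hc Hp). assert (H2 := disc_aut_den c q Hc Hq).
  rewrite Cmod_div by (apply Cmult_neq_0; assumption).
  rewrite !Cmod_mult, RtoC_Cmod_sq, Cmod_R.
  assert (Gc := Cmod_sq_lt1 c Hc). assert (Gp := Cmod_sq_lt1 p Hp). assert (Gq := Cmod_sq_lt1 q Hq).
  rewrite Rabs_pos_eq by lra.
  apply Cmod_gt_0 in H1. apply Cmod_gt_0 in H2.
  field. repeat split; lra.
Qed.

Lemma disc_aut_self_map (c : C) : Disc c -> disc_self_map (disc_aut c).
Proof.
  intros Hc. split.
  - intros z Hz. eexists. apply cdiff_moebius. apply disc_aut_den; assumption.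
  - intros z Hz. apply disc_aut_disc; assumption.
Qed.

Lemma disc_self_map_comp (f g : C -> C) : disc_self_map f -> disc_self_map g -> disc_self_map (fun z => f (g z)).
Proof.
  intros [Hf1 Hf2] [Hg1 Hg2]. split.
  - intros z Hz. destruct (Hg1 z Hz) as [m Hm]. destruct (Hf1 (g z) (Hg2 z Hz)) as [l Hl].
    exists (l * m)%C. apply cdiff_comp; assumption.
  - intros z Hz. apply Hf2, Hg2, Hz.
Qed.

(** Precompose with the automorphism carrying 0 to [z] and postcompose with the one carrying [f z] to
0: the result fixes 0, and the chain rule turns the bound of its derivative by 1 into this one. *)
Lemma schwarz_pick_derivative (f : C -> C) (z l : C) : disc_self_map f -> Disc z -> cdiff f z l ->
  Cmod l * (1 - Cmod z ^ 2) <= 1 - Cmod (f z) ^ 2.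
Proof.
  intros Hf Hz Hl.
  assert (Hfz : Disc (f z)) by (apply Hf, Hz).
  set (c := f z) in *.
  assert (H1 := cdiff_moebius 1 z (Cconj z) 1 0). fold (disc_aut z) in H1.
  specialize (H1 (disc_aut_den z 0 Hz Disc_0)).
  rewrite <- (disc_aut_0 z) in Hl.
  assert (H2 := cdiff_comp f (disc_aut z) 0 _ _ H1 Hl).
  assert (Hfc : f (disc_aut z 0) = c) by (rewrite disc_aut_0; reflexivity).
  assert (H3 := cdiff_moebius 1 (- c) (Cconj (- c)) 1 c). fold (disc_aut (- c)) in H3.
  specialize (H3 (disc_aut_den (- c) c (Disc_opp c Hfz) Hfz)).
  assert (H4 := fun d => cdiff_comp (disc_aut (- c)) (fun w => f (disc_aut z w)) 0 d _ H2).
  cbv beta in H4. rewrite Hfc in H4. specialize (H4 _ H3).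
  apply schwarz_derivative in H4.
  - assert (Gz := Cmod_sq_lt1 z Hz). assert (Gc := Cmod_sq_lt1 c Hfz).
    set (A := RtoC (1 - Cmod z ^ 2)) in *. set (B := RtoC (1 - Cmod c ^ 2)) in *.
    assert (NB : B <> 0%C) by (unfold B; intros E; injection E; lra).
    match type of H4 with Cmod ?X <= 1 => replace X with (l * A / B)%C in H4 end.
    2:{ unfold A, B. rewrite <- !RtoC_Cmod_sq, Copp_conj. field.
        assert (N1 := disc_aut_den (- c) c (Disc_opp c Hfz) Hfz).
        rewrite Copp_conj in N1. exact N1. }
    rewrite Cmod_div, Cmod_mult in H4 by exact NB. unfold A, B in H4. rewrite !Cmod_R, !Rabs_pos_eq in H4 by lra.
    apply Rmult_le_compat_r with (r := 1 - Cmod c ^ 2) in H4; [|lra].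
    unfold Rdiv in H4. rewrite (Rmult_assoc (_ * _)), Rinv_l in H4 by lra. lra.
  - apply disc_self_map_comp. apply disc_aut_self_map, Disc_opp, Hfz.
    apply disc_self_map_comp. exact Hf. apply disc_aut_self_map, Hz.
  - simpl. rewrite disc_aut_0. fold c. apply disc_aut_opp_self, Hfz.
Qed.

(** Project the image of the radius through [z] on the direction of [g z]: the real function [v]
so obtained satisfies [v' / (1 - v^2) <= 1 / (1 - t^2)], because [|v|] is at most [|g|]. Hence
[artanh v - artanh t] decreases from 0; [phi] is twice this difference. Projecting avoids
differentiating [|g|], which is not smooth at the zeros of [g]. *)
Lemma schwarz (g : C -> C) (z : C) : disc_self_map g -> g 0%C = 0%C -> Disc z -> Cmod (g z) <= Cmod z.
Proof.
  intros Hg H0 Hz.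
  pose proof (Cmod_ge_0 z) as Pz. pose proof (Cmod_ge_0 (g z)) as Pg.
  destruct (Req_dec (Cmod z) 0) as [E|Nz].
  { apply Cmod_eq_0 in E. rewrite E, H0. lra. }
  destruct (Req_dec (Cmod (g z)) 0) as [E|Ng]; [lra|].
  assert (Nz' : RtoC (Cmod z) <> 0%C) by (intros E; injection E; exact Nz).
  assert (Ng' : RtoC (Cmod (g z)) <> 0%C) by (intros E; injection E; exact Ng).
  set (rho := Cmod z) in *.
  set (e := (z / RtoC rho)%C). set (k := (Cconj (g z) / RtoC (Cmod (g z)))%C).
  assert (He : Cmod e = 1).
  { unfold e. rewrite Cmod_div by exact Nz'. rewrite Cmod_R, Rabs_pos_eq by exact Pz. fold rho. field; exact Nz. }
  assert (Hk : Cmod k = 1).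
  { unfold k. rewrite Cmod_div by exact Ng'. rewrite Cmod_conj, Cmod_R, Rabs_pos_eq by exact Pg. field; exact Ng. }
  assert (Hrho : rho < 1) by exact Hz.
  set (v := fun t : R => Re (k * g (0 + t * e))%C).
  assert (Hin : forall t, 0 <= t <= rho -> Cmod (0 + t * e)%C = t).
  { intros t Ht. replace (0 + t * e)%C with (t * e)%C by ring. rewrite Cmod_mult, He, Cmod_R, Rabs_pos_eq; lra. }
  assert (HD : forall t, 0 <= t <= rho -> Disc (0 + t * e)%C).
  { intros t Ht. unfold Disc. rewrite Hin; lra. }
  assert (Hv1 : forall t, 0 <= t <= rho -> v t ^ 2 <= Cmod (g (0 + t * e)%C) ^ 2 /\ Cmod (g (0 + t * e)%C) ^ 2 < 1).
  { intros t Ht.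
    assert (M : Disc (g (0 + t * e)%C)) by apply Hg, HD, Ht.
    assert (V := Rabs_Re_le (k * g (0 + t * e))%C). rewrite Cmod_mult, Hk, Rmult_1_l in V.
    fold (v t) in V. unfold Disc in M. pose proof (Cmod_ge_0 (g (0 + t * e)%C)).
    split; [|nra]. rewrite <- (pow2_abs (v t)). pose proof (Rabs_pos (v t)). nra. }
  assert (Hder : forall t, 0 <= t <= rho -> exists dv, is_derive v t dv /\ dv * (1 - t ^ 2) <= 1 - v t ^ 2).
  { intros t Ht. destruct (proj1 Hg _ (HD t Ht)) as [l Hl].
    exists (Re (k * (l * e))%C). split. apply is_derive_Re_line, Hl.
    assert (SP := schwarz_pick_derivative g _ l Hg (HD t Ht) Hl). rewrite Hin in SP by exact Ht.
    assert (V := Rle_trans _ _ _ (Rle_abs _) (Rabs_Re_le (k * (l * e))%C)).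
    rewrite !Cmod_mult, Hk, He in V. destruct (Hv1 t Ht) as [V1 V2].
    assert (0 < 1 - t ^ 2) by nra. nra. }
  set (phi := fun t => ln (1 + v t) - ln (1 - v t) - ln (1 + t) + ln (1 - t)).
  assert (Hphi : forall t, 0 <= t <= rho -> exists d, is_derive phi t d /\ d <= 0).
  { intros t Ht. destruct (Hder t Ht) as [dv [D1 D2]]. destruct (Hv1 t Ht) as [V1 V2].
    assert (-1 < v t < 1) by nra.
    exists (dv / (1 + v t) + dv / (1 - v t) - / (1 + t) - / (1 - t)). split.
    - unfold phi. auto_derive.
      + assert (Ev : ex_derive v t) by (exists dv; exact D1). repeat split; try exact Ev; lra.
      + replace (Derive (fun x => v x) t) with dv by (symmetry; apply is_derive_unique, D1).
        field. lra.
    - replace (dv / (1 + v t) + dv / (1 - v t) - / (1 + t) - / (1 - t)) with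
        (2 * (dv * (1 - t ^ 2) - (1 - v t ^ 2)) / ((1 - t ^ 2) * (1 - v t ^ 2))).
      2:{ field. repeat split; nra. }
      assert (0 < (1 - t ^ 2) * (1 - v t ^ 2)) by (apply Rmult_lt_0_compat; nra).
      apply Rmult_le_reg_r with ((1 - t ^ 2) * (1 - v t ^ 2)); [assumption|].
      unfold Rdiv. rewrite Rmult_assoc, Rinv_l by lra. lra. }
  assert (Hdec : phi rho <= phi 0).
  { destruct (MVT_gen phi 0 rho (Derive phi)) as [c [Hc1 Hc2]].
    - rewrite Rmin_left, Rmax_right by exact Pz. intros x Hx.
      destruct (Hphi x) as [d [D1 _]]; [lra|]. apply Derive_correct. exists d; exact D1.
    - rewrite Rmin_left, Rmax_right by exact Pz. intros x Hx.
      destruct (Hphi x) as [d [D1 _]]; [lra|]. apply continuity_pt_filterlim.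
      apply (ex_derive_continuous phi). exists d; exact D1.
    - rewrite Rmin_left, Rmax_right in Hc1 by exact Pz.
      destruct (Hphi c Hc1) as [d [D1 D2]]. rewrite (is_derive_unique _ _ _ D1) in Hc2. nra. }
  assert (Ev0 : v 0 = 0).
  { unfold v. replace (0 + 0 * e)%C with (RtoC 0) by ring. rewrite H0, Cmult_0_r. reflexivity. }
  assert (Evr : v rho = Cmod (g z)).
  { unfold v. replace (0 + rho * e)%C with z by (unfold e; field; exact Nz').
    unfold k. replace (Cconj (g z) / RtoC (Cmod (g z)) * g z)%C with (RtoC (Cmod (g z))). reflexivity.
    transitivity ((g z * Cconj (g z)) / RtoC (Cmod (g z)))%C; [|field; exact Ng'].
    rewrite <- Cmod2_conj. unfold Rsqr. simpl. rewrite Rmult_1_r, RtoC_mult. field. exact Ng'. }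
  unfold phi in Hdec. rewrite Ev0, Evr in Hdec. rewrite Rplus_0_r, Rminus_0_r, ln_1 in Hdec.
  assert (Hg1 : Cmod (g z) < 1) by (apply Hg, Hz).
  destruct (Rle_lt_dec (Cmod (g z)) rho) as [|Hlt]; [assumption|exfalso].
  assert (ln (1 + rho) < ln (1 + Cmod (g z))) by (apply ln_increasing; lra).
  assert (ln (1 - Cmod (g z)) < ln (1 - rho)) by (apply ln_increasing; lra).
  lra.
Qed.

Lemma sinh2_dist_0 (p : C) : Disc p -> sinh2_dist p 0%C = / (1 - Cmod p ^ 2) - 1.
Proof.
  intros Hp. unfold sinh2_dist. rewrite Cmod_0. replace (p - 0)%C with p by ring.
  field. assert (G := Cmod_sq_lt1 p Hp). lra.
Qed.

Lemma schwarz_pick (f : C -> C) (p q : C) : disc_self_map f -> Disc p -> Disc q ->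
  sinh2_dist (f p) (f q) <= sinh2_dist p q.
Proof.
  intros Hf Hp Hq.
  assert (Hfp : Disc (f p)) by (apply Hf, Hp). assert (Hfq : Disc (f q)) by (apply Hf, Hq).
  set (g := fun z => disc_aut (- f q) (f (disc_aut q z))).
  assert (Hg : disc_self_map g).
  { apply (disc_self_map_comp (disc_aut (- f q)) (fun z => f (disc_aut q z))). apply disc_aut_self_map, Disc_opp, Hfq.
    apply disc_self_map_comp. exact Hf. apply disc_aut_self_map, Hq. }
  set (p' := disc_aut (- q) p).
  assert (Hp' : Disc p') by (apply disc_aut_disc; [apply Disc_opp, Hq|exact Hp]).
  assert (G0 : g 0%C = 0%C) by (unfold g; rewrite disc_aut_0; apply disc_aut_opp_self, Hfq).
  assert (S := schwarz g p' Hg G0 Hp').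
  assert (Egp : g p' = disc_aut (- f q) (f p)) by (unfold g, p'; rewrite disc_aut_cancel by assumption; reflexivity).
  rewrite <- (sinh2_dist_disc_aut (- f q) (f p) (f q)); try apply Disc_opp; try assumption.
  rewrite disc_aut_opp_self by exact Hfq. rewrite <- Egp.
  rewrite <- (sinh2_dist_disc_aut (- q) p q); try apply Disc_opp; try assumption.
  rewrite disc_aut_opp_self by exact Hq. fold p'.
  assert (Hgp : Disc (g p')) by (apply Hg, Hp').
  rewrite !sinh2_dist_0 by assumption.
  assert (A := Cmod_sq_lt1 _ Hp').
  apply Rplus_le_compat_r. apply Rinv_le_contravar. exact A.
  pose proof (Cmod_ge_0 (g p')). nra.
Qed.

(** * The Poincare distance and the Kobayashi distance of the disc *)

Lemma cosh_add (x y : R) : cosh (x + y) = cosh x * cosh y + sinh x * sinh y.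
Proof. unfold cosh, sinh. rewrite Ropp_plus_distr, !exp_plus. field. Qed.

Lemma cosh2_sinh2 (x : R) : cosh x ^ 2 - 1 = sinh x ^ 2.
Proof.
  unfold cosh, sinh. assert (E : exp x * exp (- x) = 1).
  { rewrite <- exp_plus. replace (x + - x) with 0 by ring. apply exp_0. }
  nra.
Qed.

Lemma sinh_nonneg (x : R) : 0 <= x -> 0 <= sinh x.
Proof.
  intros Hx. unfold sinh. assert (exp (- x) <= exp x); [|lra].
  destruct (Req_dec x 0) as [->|Hn]. rewrite Ropp_0; lra. left; apply exp_increasing; lra.
Qed.

Lemma cosh_le_inv (x y : R) : 0 <= y -> cosh x <= cosh y -> x <= y.
Proof.
  intros Hy H. destruct (Rle_lt_dec x y) as [|Hlt]; [assumption|exfalso].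
  replace x with ((x - y) + y) in H by ring. rewrite cosh_add in H.
  assert (S1 := sinh_nonneg y Hy). assert (S2 := sinh_nonneg (x - y) ltac:(lra)).
  assert (S3 : 0 < sinh (x - y)).
  { unfold sinh. assert (exp (- (x - y)) < exp (x - y)) by (apply exp_increasing; lra). lra. }
  assert (C1 : 1 <= cosh y).
  { assert (Q := cosh2_sinh2 y). assert (0 < cosh y); [|nra]. unfold cosh.
    pose proof (exp_pos y). pose proof (exp_pos (- y)). lra. }
  assert (C2 : 1 < cosh (x - y)).
  { assert (Q := cosh2_sinh2 (x - y)). assert (0 < cosh (x - y)); [|nra]. unfold cosh.
    pose proof (exp_pos (x - y)). pose proof (exp_pos (- (x - y))). lra. }
  nra.
Qed.

Lemma cosh_inj (x y : R) : 0 <= x -> 0 <= y -> cosh x = cosh y -> x = y.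
Proof. intros Hx Hy H. apply Rle_antisym; apply cosh_le_inv; lra. Qed.

Definition pseudo_dist (p q : C) : R := Cmod ((p - q) / (1 - Cconj q * p))%C.

Lemma pseudo_den (p q : C) : Disc p -> Disc q -> (1 - Cconj q * p)%C <> 0%C.
Proof.
  intros Hp Hq E. apply (disc_aut_den (- q)%C p (Disc_opp q Hq) Hp).
  rewrite Copp_conj, <- E. ring.
Qed.

Lemma pseudo_dist_sq (p q : C) : Disc p -> Disc q ->
  pseudo_dist p q ^ 2 = sinh2_dist p q / (1 + sinh2_dist p q).
Proof.
  intros Hp Hq. assert (Hn := pseudo_den p q Hp Hq).
  unfold pseudo_dist. rewrite Cmod_div by exact Hn.
  assert (E : Cmod (1 - Cconj q * p)%C ^ 2 = Cmod (p - q)%C ^ 2 + (1 - Cmod p ^ 2) * (1 - Cmod q ^ 2)).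
  { rewrite !Cmod2_alt. destruct p, q. simpl. ring. }
  apply Cmod_gt_0 in Hn.
  assert (Gp := Cmod_sq_lt1 p Hp). assert (Gq := Cmod_sq_lt1 q Hq).
  assert (G : 0 < (1 - Cmod p ^ 2) * (1 - Cmod q ^ 2)) by (apply Rmult_lt_0_compat; assumption).
  unfold sinh2_dist. unfold Rdiv at 1. rewrite Rpow_mult_distr, pow_inv, E.
  pose proof (pow2_ge_0 (Cmod (p - q)%C)).
  field. repeat split; lra.
Qed.

Lemma sinh2_dist_nonneg (p q : C) : Disc p -> Disc q -> 0 <= sinh2_dist p q.
Proof.
  intros Hp Hq. unfold sinh2_dist.
  assert (Gp := Cmod_sq_lt1 p Hp). assert (Gq := Cmod_sq_lt1 q Hq).
  apply Rmult_le_pos. apply pow2_ge_0. left; apply Rinv_0_lt_compat, Rmult_lt_0_compat; assumption.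
Qed.

Lemma pseudo_dist_bounds (p q : C) : Disc p -> Disc q -> 0 <= pseudo_dist p q < 1.
Proof.
  intros Hp Hq. assert (P : 0 <= pseudo_dist p q) by apply Cmod_ge_0.
  split; [exact P|].
  assert (E := pseudo_dist_sq p q Hp Hq). assert (S := sinh2_dist_nonneg p q Hp Hq).
  assert (E' : pseudo_dist p q ^ 2 = 1 - / (1 + sinh2_dist p q)) by (rewrite E; field; lra).
  assert (0 < / (1 + sinh2_dist p q)) by (apply Rinv_0_lt_compat; lra). nra.
Qed.

Lemma poincare_dist_nonneg (p q : C) : Disc p -> Disc q -> 0 <= poincare_dist p q.
Proof.
  intros Hp Hq. assert (B := pseudo_dist_bounds p q Hp Hq).
  unfold poincare_dist. fold (pseudo_dist p q). cbv zeta.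
  set (d := pseudo_dist p q) in *.
  assert (1 <= (1 + d) / (1 - d)).
  { apply Rmult_le_reg_r with (1 - d); [lra|]. unfold Rdiv. rewrite Rmult_assoc, Rinv_l by lra. lra. }
  assert (0 <= ln ((1 + d) / (1 - d))); [|lra].
  rewrite <- ln_1. apply ln_le; lra.
Qed.

Lemma cosh_poincare_dist (p q : C) : Disc p -> Disc q ->
  cosh (2 * poincare_dist p q) = 1 + 2 * sinh2_dist p q.
Proof.
  intros Hp Hq. assert (B := pseudo_dist_bounds p q Hp Hq).
  assert (E := pseudo_dist_sq p q Hp Hq). assert (S := sinh2_dist_nonneg p q Hp Hq).
  unfold poincare_dist. fold (pseudo_dist p q). cbv zeta.
  set (d := pseudo_dist p q) in *.
  replace (2 * (/ 2 * ln ((1 + d) / (1 - d)))) with (ln ((1 + d) / (1 - d))) by field.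
  assert (0 < (1 + d) / (1 - d)) by (apply Rdiv_lt_0_compat; lra).
  unfold cosh. rewrite <- ln_Rinv, !exp_ln; try assumption; [|apply Rinv_0_lt_compat; assumption].
  replace (((1 + d) / (1 - d) + / ((1 + d) / (1 - d))) / 2) with ((1 + d ^ 2) / (1 - d ^ 2)).
  2:{ field. repeat split; nra. }
  rewrite E. field. repeat split; lra.
Qed.

Lemma poincare_dist_le (p q p' q' : C) : Disc p -> Disc q -> Disc p' -> Disc q' ->
  sinh2_dist p q <= sinh2_dist p' q' -> poincare_dist p q <= poincare_dist p' q'.
Proof.
  intros Hp Hq Hp' Hq' H.
  assert (2 * poincare_dist p q <= 2 * poincare_dist p' q'); [|lra].
  apply cosh_le_inv. assert (N := poincare_dist_nonneg p' q' Hp' Hq'). lra.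
  rewrite !cosh_poincare_dist by assumption. lra.
Qed.

Lemma poincare_dist_eq (p q : C) (x : R) : Disc p -> Disc q -> 0 <= x ->
  1 + 2 * sinh2_dist p q = cosh (2 * x) -> poincare_dist p q = x.
Proof.
  intros Hp Hq Hx H. assert (N := poincare_dist_nonneg p q Hp Hq).
  assert (2 * poincare_dist p q = 2 * x); [|lra].
  apply cosh_inj; try lra. rewrite cosh_poincare_dist by assumption. exact H.
Qed.

(** The determinant of the rows [(1 + |z|^2, Re z, Im z)] for [z = p, q, r]. Up to a positive factor
such a row is the lift of [z] to the hyperboloid model, in which geodesics are plane sections, so the
determinant vanishes exactly for points on a common geodesic. Being polynomial, it makes sense for
boundary points too. *)
Definition collinearity (p q r : C) : R :=
  let n z := 1 + Re z ^ 2 + Im z ^ 2 in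
  n p * (Re q * Im r - Im q * Re r) - n q * (Re p * Im r - Im p * Re r)
  + n r * (Re p * Im q - Im p * Re q).

(** [A], [B], [D] are the hyperbolic cosines of twice the mutual distances, that is, the Lorentz
products of the lifts to the hyperboloid. Their Gram determinant [1 + 2 A B D - A^2 - B^2 - D^2],
which is the left-hand side, is the square of the determinant of the three lifts. *)
Lemma gram_identity (p q r : C) : Disc p -> Disc q -> Disc r ->
  let A := 1 + 2 * sinh2_dist p q in
  let B := 1 + 2 * sinh2_dist q r in
  let D := 1 + 2 * sinh2_dist p r in
  (A ^ 2 - 1) * (B ^ 2 - 1) - (D - A * B) ^ 2 =
  (4 * collinearity p q r / ((1 - Cmod p ^ 2) * (1 - Cmod q ^ 2) * (1 - Cmod r ^ 2))) ^ 2.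
Proof.
  intros Hp Hq Hr. unfold sinh2_dist, collinearity.
  assert (Gp := Cmod_sq_lt1 p Hp). assert (Gq := Cmod_sq_lt1 q Hq). assert (Gr := Cmod_sq_lt1 r Hr).
  rewrite Cmod2_alt in Gp, Gq, Gr. rewrite !Cmod2_alt.
  destruct p as [p1 p2], q as [q1 q2], r as [r1 r2]. simpl Re in *. simpl Im in *. cbv zeta.
  field. repeat split; lra.
Qed.

(** With the addition formula for [cosh], the nonnegativity of the Gram determinant reads
[cosh (2 d p r) <= cosh (2 d p q + 2 d q r)]. *)
Lemma poincare_triangle (p q r : C) : Disc p -> Disc q -> Disc r ->
  poincare_dist p r <= poincare_dist p q + poincare_dist q r.
Proof.
  intros Hp Hq Hr. assert (G := gram_identity p q r Hp Hq Hr). cbv zeta in G.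
  rewrite <- !cosh_poincare_dist in G by assumption. rewrite !cosh2_sinh2 in G.
  assert (N1 := poincare_dist_nonneg p q Hp Hq). assert (N2 := poincare_dist_nonneg q r Hq Hr).
  assert (2 * poincare_dist p r <= 2 * poincare_dist p q + 2 * poincare_dist q r); [|lra].
  apply cosh_le_inv; [lra|]. rewrite cosh_add.
  assert (S1 := sinh_nonneg (2 * poincare_dist p q) ltac:(lra)).
  assert (S2 := sinh_nonneg (2 * poincare_dist q r) ltac:(lra)).
  match type of G with _ = ?X ^ 2 => pose proof (pow2_ge_0 X) end.
  assert (0 <= sinh (2 * poincare_dist p q) * sinh (2 * poincare_dist q r)) by (apply Rmult_le_pos; assumption).
  nra.
Qed.

(** Equality in the triangle inequality makes the Gram determinant vanish. *)
Lemma collinear_of_triangle_eq (p q r : C) : Disc p -> Disc q -> Disc r ->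
  poincare_dist p q + poincare_dist q r <= poincare_dist p r -> collinearity p q r = 0.
Proof.
  intros Hp Hq Hr Hle. assert (G := gram_identity p q r Hp Hq Hr). cbv zeta in G.
  rewrite <- !cosh_poincare_dist in G by assumption.
  assert (T := poincare_triangle p q r Hp Hq Hr).
  assert (E : 2 * poincare_dist p r = 2 * poincare_dist p q + 2 * poincare_dist q r) by lra.
  rewrite E, cosh_add, !cosh2_sinh2 in G.
  assert (Gp := Cmod_sq_lt1 p Hp). assert (Gq := Cmod_sq_lt1 q Hq). assert (Gr := Cmod_sq_lt1 r Hr).
  set (P := (1 - Cmod p ^ 2) * (1 - Cmod q ^ 2) * (1 - Cmod r ^ 2)) in *.
  assert (HP : 0 < P) by (repeat apply Rmult_lt_0_compat; assumption).
  assert (Z : (4 * collinearity p q r / P) ^ 2 = 0) by (rewrite <- G; ring).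
  assert (Z' : 4 * collinearity p q r / P = 0) by nra.
  apply Rmult_eq_reg_r with (4 / P). 2:{ apply Rgt_not_eq, Rdiv_lt_0_compat; lra. }
  rewrite Rmult_0_l, <- Z'. field. lra.
Qed.

Lemma poincare_dist_refl (p : C) : poincare_dist p p = 0.
Proof.
  unfold poincare_dist. replace ((p - p) / (1 - Cconj p * p))%C with (RtoC 0).
  2:{ unfold Cdiv. ring. }
  rewrite Cmod_0. replace ((1 + 0) / (1 - 0)) with 1 by field. rewrite ln_1. ring.
Qed.

Lemma disc_self_map_of_holomorphic (f : C -> C) : holomorphic_map Disc Disc f -> disc_self_map f.
Proof.
  intros [H1 H2]. split; [|exact H2]. intros z Hz. apply cdiff_of_ex_derive, H1, Hz.
Qed.

Lemma disc_chain_ge (z w : C) (l : R) : disc_chain Disc z w l ->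
  Disc z /\ Disc w /\ poincare_dist z w <= l.
Proof.
  induction 1 as [z Hz|phi p q w l Hphi Hp Hq _ (IH1 & IH2 & IH3)].
  - rewrite poincare_dist_refl. repeat split; try assumption; lra.
  - assert (H := disc_self_map_of_holomorphic phi Hphi).
    assert (Hpp : Disc (phi p)) by apply H, Hp.
    repeat split; try assumption.
    eapply Rle_trans. apply (poincare_triangle _ (phi q)); assumption.
    apply Rplus_le_compat; [|exact IH3].
    apply poincare_dist_le; try assumption. apply schwarz_pick; assumption.
Qed.

Lemma holomorphic_map_id : holomorphic_map Disc Disc (fun z => z).
Proof.
  split; [|intros z Hz; exact Hz]. intros z _. 
  exists (RtoC 1). split.
  - apply (is_linear_scal_l (K := C_AbsRing) (V := C_NormedModule)).
  - intros y _ eps. exists eps. intros w Hw.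
    change (Cmod (w + - y + - ((w + - y) * 1))%C <= eps * Cmod (w + - y)%C).
    replace (w + - y + - ((w + - y) * 1))%C with (RtoC 0) by ring.
    rewrite Cmod_0. apply Rmult_le_pos. left; apply cond_pos. apply Cmod_ge_0.
Qed.

(** The identity is a chain of length the Poincare distance, and Schwarz-Pick shows that it is the
shortest one; the infimum is attained. *)
Lemma kobayashi_disc (p q : C) : Disc p -> Disc q -> kobayashi Disc p q = poincare_dist p q.
Proof.
  intros Hp Hq. unfold kobayashi.
  rewrite (is_glb_Rbar_unique _ (Finite (poincare_dist p q))). reflexivity.
  split.
  - intros l Hl. apply disc_chain_ge in Hl. exact (proj2 (proj2 Hl)).
  - intros b Hb. apply Hb. rewrite <- (Rplus_0_r (poincare_dist p q)).
    apply (disc_chain_step Disc (fun z => z) p q q 0 holomorphic_map_id Hp Hq).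
    apply disc_chain_refl, Hq.
Qed.

(** * The topology of the plane and the frontier of the disc *)

Lemma locally_Cmod (a : C) (eps : R) : 0 < eps -> locally a (fun w : C => Cmod (w - a)%C < eps).
Proof.
  intros He. assert (Hs : 0 < sqrt 2) by (apply sqrt_lt_R0; lra).
  assert (Hd : 0 < eps / sqrt 2) by (apply Rdiv_lt_0_compat; assumption).
  exists (mkposreal _ Hd). intros w Hw.
  apply C_NormedModule_mixin_compat2 in Hw. simpl in Hw.
  replace (sqrt 2 * (eps / sqrt 2)) with eps in Hw by (field; lra). exact Hw.
Qed.

Lemma locally_C_elim (a : C) (P : C -> Prop) : locally a P ->
  exists eps, 0 < eps /\ forall w : C, Cmod (w - a)%C < eps -> P w.
Proof.
  intros [eps H]. exists eps. split; [apply cond_pos|]. intros w Hw. apply H.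
  apply C_NormedModule_mixin_compat1. exact Hw.
Qed.

Lemma continuous_on_dominated (D : R -> Prop) (gamma : R -> C) (g : R -> R) (K : R) :
  (forall x, D x -> continuous g x) ->
  (forall x y, D x -> D y -> Cmod (gamma y - gamma x)%C <= K * Rabs (g y - g x)) ->
  continuous_on D gamma.
Proof.
  intros Hg H x Hx P HP. apply locally_C_elim in HP. destruct HP as [eps [He HP]].
  assert (HK : 0 < 1 + Rabs K) by (pose proof (Rabs_pos K); lra).
  assert (Hd : 0 < eps / (1 + Rabs K)) by (apply Rdiv_lt_0_compat; assumption).
  assert (L : locally (g x) (fun y => Rabs (y - g x) < eps / (1 + Rabs K))) by (exists (mkposreal _ Hd); intros y Hy; exact Hy).
  specialize (Hg x Hx _ L). unfold within, filtermap in *.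
  revert Hg. apply filter_imp. intros y Hy Dy. apply HP.
  eapply Rle_lt_trans. apply H; assumption.
  apply Rmult_lt_compat_l with (r := 1 + Rabs K) in Hy; [|lra].
  replace ((1 + Rabs K) * (eps / (1 + Rabs K))) with eps in Hy by (field; lra).
  pose proof (Rle_abs K). pose proof (Rabs_pos (g y - g x)). nra.
Qed.

Lemma frontier_disc (a : C) : frontier Disc a <-> Cmod a = 1.
Proof.
  split.
  - intros [H1 H2]. unfold Disc in *.
    destruct (Rtotal_order (Cmod a) 1) as [Hlt|[E|Hgt]]; [exfalso|exact E|exfalso].
    + destruct (H2 _ (locally_Cmod a (1 - Cmod a) ltac:(lra))) as [w [W1 W2]].
      apply W2. replace w with ((w - a) + a)%C by ring. eapply Rle_lt_trans. apply Cmod_triangle. lra.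
    + destruct (H1 _ (locally_Cmod a (Cmod a - 1) ltac:(lra))) as [w [W1 W2]].
      assert (Cmod a <= Cmod w + Cmod (w - a)%C); [|lra].
      replace a with (w + - (w - a))%C at 1 by ring. eapply Rle_trans. apply Cmod_triangle.
      rewrite Cmod_opp. lra.
  - intros E. split; intros P HP.
    + apply locally_C_elim in HP. destruct HP as [eps [He HP]].
      set (eta := Rmin (eps / 2) (1 / 2)).
      assert (E1 : 0 < eta) by (apply Rmin_pos; lra).
      assert (E2 : eta <= eps / 2) by apply Rmin_l. assert (E3 : eta <= 1 / 2) by apply Rmin_r.
      exists (RtoC (1 - eta) * a)%C. split.
      * apply HP. replace (RtoC (1 - eta) * a - a)%C with (RtoC (- eta) * a)%C by (rewrite RtoC_minus, RtoC_opp; ring).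
        rewrite Cmod_mult, E, Cmod_R, Rabs_Ropp, Rabs_pos_eq; lra.
      * unfold Disc. rewrite Cmod_mult, E, Cmod_R, Rabs_pos_eq; lra.
    + exists a. split. apply locally_singleton, HP. unfold Disc. lra.
Qed.

(** * Lengths, minimizing segments and collinearity *)

Lemma length_ge_broken_line (Omega : C -> Prop) (gamma : R -> C) (s u t : R) : s <= u <= t ->
  Rbar_le (kobayashi Omega (gamma s) (gamma u) + kobayashi Omega (gamma u) (gamma t))
    (kobayashi_length Omega gamma s t).
Proof.
  intros Hu. apply (Lub_Rbar_correct _).
  exists 1%nat, (fun i => match i with O => s | S O => u | _ => t end).
  repeat split.
  intros [|[|i]] Hi; [apply Hu|apply Hu|lia].
Qed.

Lemma length_ge_kobayashi (Omega : C -> Prop) (gamma : R -> C) (s t : R) : s <= t ->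
  Rbar_le (kobayashi Omega (gamma s) (gamma t)) (kobayashi_length Omega gamma s t).
Proof.
  intros Hu. apply (Lub_Rbar_correct _).
  exists 0%nat, (fun i => match i with O => s | _ => t end).
  repeat split.
  intros [|i] Hi; [exact Hu|lia].
Qed.

(** The sum over any subdivision telescopes. *)
Lemma length_le_of_potential (gamma : R -> C) (h : R -> R) (s t : R) :
  (forall r, s <= r <= t -> Disc (gamma r)) ->
  (forall x y, s <= x -> x <= y -> y <= t -> poincare_dist (gamma x) (gamma y) <= h y - h x) ->
  Rbar_le (kobayashi_length Disc gamma s t) (h t - h s).
Proof.
  intros HD H. apply (Lub_Rbar_correct _).
  intros l (n & x & X0 & Xn & Xm & ->). simpl.
  assert (M1 : forall i, (i <= S n)%nat -> s <= x i).
  { induction i as [|i IH]; intros Hi. lra. specialize (Xm i ltac:(lia)). specialize (IH ltac:(lia)). lra. }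
  assert (M2 : forall j i, (i + j = S n)%nat -> x i <= t).
  { induction j as [|j IH]; intros i Hi. replace i with (S n) by lia. lra.
    specialize (Xm i ltac:(lia)). specialize (IH (S i) ltac:(lia)). lra. }
  assert (M3 : forall i, (i <= S n)%nat -> x i <= t) by (intros i Hi; apply (M2 (S n - i)%nat); lia).
  assert (Hk : forall i, (i <= n)%nat ->
    kobayashi Disc (gamma (x i)) (gamma (x (S i))) <= h (x (S i)) - h (x i)).
  { intros i Hi. assert (A1 := M1 i ltac:(lia)). assert (A2 := M3 i ltac:(lia)).
    assert (A3 := M1 (S i) ltac:(lia)). assert (A4 := M3 (S i) ltac:(lia)).
    rewrite kobayashi_disc by (apply HD; lra). apply H; try assumption. apply Xm, Hi. }
  assert (Hs : forall k, (k <= n)%nat ->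
    sum_f_R0 (fun i => kobayashi Disc (gamma (x i)) (gamma (x (S i)))) k <= h (x (S k)) - h (x 0%nat)).
  { induction k as [|k IH]; intros Hi; simpl. apply Hk; lia.
    specialize (IH ltac:(lia)). specialize (Hk (S k) Hi). lra. }
  specialize (Hs n (Nat.le_refl n)). rewrite Xn, X0 in Hs. exact Hs.
Qed.

(** A curve along which the distance is additive has the distance of its endpoints as its length,
and no competitor is shorter than that. *)
Lemma geodesic_segment_of_arclength (gamma : R -> C) (h : R -> R) (s t : R) : s <= t ->
  curve_in Disc gamma s t ->
  (forall x y, s <= x -> x <= y -> y <= t -> poincare_dist (gamma x) (gamma y) = h y - h x) ->
  geodesic_segment Disc gamma s t.
Proof.
  intros Hst Hc H. split; [exact Hc|].
  intros eta u v Huv [Heta1 Heta2] Eu Ev.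
  apply Rbar_le_trans with (h t - h s).
  - apply length_le_of_potential. apply Hc. intros. right. apply H; assumption.
  - rewrite <- H by lra. rewrite <- kobayashi_disc by (apply Hc; lra).
    rewrite <- Eu, <- Ev. apply length_ge_kobayashi, Huv.
Qed.

Lemma cosh_ln (x : R) : 0 < x -> cosh (ln x) = (x + / x) / 2.
Proof.
  intros Hx. unfold cosh. rewrite <- ln_Rinv, !exp_ln; try assumption. reflexivity.
  apply Rinv_0_lt_compat, Hx.
Qed.

Lemma disc_aut_lipschitz (c z w : C) : Disc c -> Disc z -> Disc w ->
  Cmod (disc_aut c z - disc_aut c w)%C <= (1 + Cmod c) / (1 - Cmod c) * Cmod (z - w)%C.
Proof.
  intros Hc Hz Hw. rewrite disc_aut_sub by assumption.
  assert (N1 := disc_aut_den c z Hc Hz). assert (N2 := disc_aut_den c w Hc Hw).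
  rewrite Cmod_div by (apply Cmult_neq_0; assumption).
  assert (G := Cmod_sq_lt1 c Hc).
  rewrite !Cmod_mult, RtoC_Cmod_sq, Cmod_R, Rabs_pos_eq by lra.
  assert (L : forall v, Disc v -> 1 - Cmod c <= Cmod (Cconj c * v + 1)%C).
  { intros v Hv. assert (1 <= Cmod (Cconj c * v + 1)%C + Cmod c * Cmod v).
    { rewrite <- Cmod_1 at 1. rewrite <- (Cmod_conj c), <- Cmod_mult.
      replace (RtoC 1) with ((Cconj c * v + 1) + - (Cconj c * v))%C at 1 by ring.
      rewrite <- (Cmod_opp (Cconj c * v)). apply Cmod_triangle. }
    unfold Disc in *. pose proof (Cmod_ge_0 c). pose proof (Cmod_ge_0 v). nra. }
  assert (L1 := L z Hz). assert (L2 := L w Hw).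
  unfold Disc in Hc. pose proof (Cmod_ge_0 c) as P. pose proof (Cmod_ge_0 (z - w)%C) as P'.
  set (k := Cmod c) in *. set (m1 := Cmod (Cconj c * z + 1)%C) in *. set (m2 := Cmod (Cconj c * w + 1)%C) in *.
  set (D := Cmod (z - w)%C) in *.
  apply Rle_trans with (D * (1 - k ^ 2) / ((1 - k) * (1 - k))).
  - unfold Rdiv. apply Rmult_le_compat_l. apply Rmult_le_pos; lra.
    apply Rinv_le_contravar. nra. apply Rmult_le_compat; lra.
  - right. field. lra.
Qed.

(** The image of a radius under the automorphism carrying 0 to [P]. Along the radius the Poincare
distance is the difference of the values of [h], the distance to 0. *)
Lemma geodesic_between (P Q : C) : Disc P -> Disc Q -> exists eta : R -> C,
  curve_in Disc eta 0 1 /\ eta 0 = P /\ eta 1 = Q /\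
  Rbar_le (kobayashi_length Disc eta 0 1) (poincare_dist P Q).
Proof.
  intros HP HQ.
  set (q := disc_aut (- P) Q).
  assert (Hq : Disc q) by (apply disc_aut_disc; [apply Disc_opp, HP|exact HQ]).
  set (eta := fun r : R => disc_aut P (r * q)%C).
  pose proof (Cmod_ge_0 q) as Pq.
  assert (Er : forall r, 0 <= r -> Cmod (r * q)%C = r * Cmod q).
  { intros r Hr. rewrite Cmod_mult, Cmod_R, Rabs_pos_eq; [reflexivity|assumption]. }
  assert (HD : forall r, 0 <= r <= 1 -> Disc (r * q)%C).
  { intros r Hr. unfold Disc in *. rewrite Er by lra. nra. }
  assert (E0 : eta 0 = P).
  { unfold eta. replace (0 * q)%C with (RtoC 0) by ring. apply disc_aut_0. }
  assert (E1 : eta 1 = Q).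
  { unfold eta. replace (1 * q)%C with q by ring. apply disc_aut_cancel; assumption. }
  assert (HE : forall r, 0 <= r <= 1 -> Disc (eta r)).
  { intros r Hr. apply disc_aut_disc. exact HP. apply HD, Hr. }
  set (h := fun r => / 2 * ln ((1 + r * Cmod q) / (1 - r * Cmod q))).
  assert (Hh : forall x y, 0 <= x -> x <= y -> y <= 1 -> poincare_dist (eta x) (eta y) = h y - h x).
  { intros x y Hx Hxy Hy. unfold Disc in Hq.
    assert (A1 : 0 <= x * Cmod q) by (apply Rmult_le_pos; assumption).
    assert (A2 : x * Cmod q <= y * Cmod q) by (apply Rmult_le_compat_r; assumption).
    assert (A3 : y * Cmod q < 1) by nra.
    assert (Ey : 0 < (1 + y * Cmod q) / (1 - y * Cmod q)) by (apply Rdiv_lt_0_compat; lra).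
    assert (Ex : 0 < (1 + x * Cmod q) / (1 - x * Cmod q)) by (apply Rdiv_lt_0_compat; lra).
    assert (Eh : h y - h x = / 2 * ln ((1 + y * Cmod q) / (1 - y * Cmod q) / ((1 + x * Cmod q) / (1 - x * Cmod q)))).
    { unfold h. rewrite (ln_div _ _ Ey Ex). ring. }
    apply poincare_dist_eq; try (apply HE; lra).
    - unfold h. assert (ln ((1 + x * Cmod q) / (1 - x * Cmod q)) <= ln ((1 + y * Cmod q) / (1 - y * Cmod q))); [|lra].
      apply ln_le; [assumption|]. unfold Rdiv. apply Rmult_le_compat; try lra.
      left; apply Rinv_0_lt_compat; lra. apply Rinv_le_contravar; lra.
    - unfold eta. rewrite sinh2_dist_disc_aut; try assumption; try (apply HD; lra).
      rewrite Eh. replace (2 * (/ 2 * ln _)) with (ln ((1 + y * Cmod q) / (1 - y * Cmod q) / ((1 + x * Cmod q) / (1 - x * Cmod q)))) by field.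
      rewrite cosh_ln by (apply Rdiv_lt_0_compat; assumption).
      unfold sinh2_dist. rewrite !Er by lra.
      replace (x * q - y * q)%C with (RtoC (x - y) * q)%C by (rewrite RtoC_minus; ring).
      rewrite Cmod_mult, Cmod_R, Rpow_mult_distr, pow2_abs.
      field. repeat split; nra. }
  exists eta. repeat split; try assumption.
  - apply (continuous_on_dominated _ eta (fun x => x) ((1 + Cmod P) / (1 - Cmod P))).
    intros; apply continuous_id.
    intros x y Hx Hy. unfold eta.
    assert (L := disc_aut_lipschitz P (y * q) (x * q) HP (HD y Hy) (HD x Hx)).
    eapply Rle_trans. exact L. unfold Disc in *. pose proof (Cmod_ge_0 P).
    apply Rmult_le_compat_l. apply Rmult_le_pos; [lra|]. left; apply Rinv_0_lt_compat; lra.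
    replace (y * q - x * q)%C with (RtoC (y - x) * q)%C by (rewrite RtoC_minus; ring).
    rewrite Cmod_mult, Cmod_R. pose proof (Rabs_pos (y - x)). nra.
  - rewrite <- E0 at 1. rewrite <- E1. rewrite (Hh 0 1) by lra.
    apply length_le_of_potential. exact HE. intros x y Hx Hxy Hy. right. apply Hh; assumption.
Qed.

(** By minimality the length between two parameters is at most that of the segment of
[geodesic_between], hence the distance of the endpoints; a subdivision at an intermediate parameter
then forces equality in the triangle inequality. The determinant is alternating, so the order of the
parameters is immaterial. *)
Lemma geodesic_line_collinear (gamma : R -> C) : geodesic_line Disc gamma ->
  forall r1 r2 r3, collinearity (gamma r1) (gamma r2) (gamma r3) = 0.
Proof.
  intros [Hg _].
  assert (HD : forall r, Disc (gamma r)).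
  { intros r. apply (Hg r r (Rle_refl r)). lra. }
  assert (Hs : forall s u t, s <= u <= t -> collinearity (gamma s) (gamma u) (gamma t) = 0).
  { intros s u t Hu. apply collinear_of_triangle_eq; try apply HD.
    destruct (geodesic_between (gamma s) (gamma t) (HD s) (HD t)) as (eta & Hc & E0 & E1 & HL).
    destruct (Hg s t ltac:(lra)) as [_ Hmin].
    assert (M := Hmin eta 0 1 ltac:(lra) Hc E0 E1).
    assert (T := length_ge_broken_line Disc gamma s u t Hu).
    assert (F := Rbar_le_trans _ _ _ T (Rbar_le_trans _ _ _ M HL)).
    simpl in F. rewrite !kobayashi_disc in F by apply HD. exact F. }
  assert (A1 : forall p q r, collinearity p q r = - collinearity q p r) by (intros; unfold collinearity; ring).
  assert (A2 : forall p q r, collinearity p q r = - collinearity p r q) by (intros; unfold collinearity; ring).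
  intros r1 r2 r3.
  destruct (Rle_dec r1 r2) as [H12|H12]; destruct (Rle_dec r2 r3) as [H23|H23]; destruct (Rle_dec r1 r3) as [H13|H13]; try lra.
  - apply Hs; lra.
  - rewrite A2, Hs; lra.
  - rewrite A2, A1, Hs; lra.
  - rewrite A1, Hs; lra.
  - rewrite A1, A2, Hs; lra.
  - rewrite A1, A2, A1, Hs; lra.
Qed.

(** * Half-plane coordinates *)

(** The isomorphism onto the right half-plane that sends [b] to infinity, chosen so that geodesic lines
ending at [b] become horizontal. *)
Definition half_plane (b z : C) : C := moebius 1 b (- (1)) b z.
(** The inverse of [half_plane a]. *)
Definition half_plane_inv (a w : C) : C := moebius a (- a) 1 1 w.

Lemma half_plane_den (b z : C) : Cmod b = 1 -> Disc z -> (- (1) * z + b)%C <> 0%C.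
Proof.
  intros Hb Hz E. unfold Disc in Hz. replace z with b in Hz. lra.
  replace b with (z + (- (1) * z + b))%C by ring. rewrite E. ring.
Qed.

Lemma Im_half_plane (b z : C) : Cmod b = 1 -> Disc z ->
  Im (half_plane b z) = 2 * (Re b * Im z - Im b * Re z) / Cmod (b - z)%C ^ 2.
Proof.
  intros Hb Hz. assert (N := half_plane_den b z Hb Hz).
  apply Cmod_gt_0 in N. replace (- (1) * z + b)%C with (b - z)%C in N by ring.
  assert (N2 : 0 < Cmod (b - z)%C ^ 2) by (apply pow_lt; exact N).
  unfold half_plane, moebius. replace (- (1) * z + b)%C with (b - z)%C by ring.
  rewrite Cmod2_alt in *. destruct b as [b1 b2], z as [x y]. simpl in *.
  field. repeat split; nra.
Qed.

Lemma Re_half_plane (b z : C) : Cmod b = 1 -> Disc z ->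
  Re (half_plane b z) = (1 - Cmod z ^ 2) / Cmod (b - z)%C ^ 2.
Proof.
  intros Hb Hz. assert (N := half_plane_den b z Hb Hz).
  apply Cmod_gt_0 in N. replace (- (1) * z + b)%C with (b - z)%C in N by ring.
  assert (N2 : 0 < Cmod (b - z)%C ^ 2) by (apply pow_lt; exact N).
  unfold half_plane, moebius. replace (- (1) * z + b)%C with (b - z)%C by ring.
  replace (1 - Cmod z ^ 2) with (Cmod b ^ 2 - Cmod z ^ 2) by (rewrite Hb; ring).
  rewrite !Cmod2_alt in *. destruct b as [b1 b2], z as [x y]. simpl in *.
  field. repeat split; nra.
Qed.

Lemma half_plane_inv_den (w : C) : 0 <= Re w -> (1 * w + 1)%C <> 0%C.
Proof. intros H E. apply (f_equal Re) in E. destruct w as [x y]. simpl in *. lra. Qed.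

Lemma half_plane_inv_sq (a w : C) : Cmod a = 1 -> 0 <= Re w ->
  1 - Cmod (half_plane_inv a w) ^ 2 = 4 * Re w / Cmod (1 * w + 1)%C ^ 2.
Proof.
  intros Ha Hw. assert (N := half_plane_inv_den w Hw).
  unfold half_plane_inv, moebius. rewrite Cmod_div by exact N.
  replace (a * w + - a)%C with (a * (w - 1))%C by ring.
  rewrite Cmod_mult, Ha, Rmult_1_l. apply Cmod_gt_0 in N.
  transitivity ((Cmod (1 * w + 1)%C ^ 2 - Cmod (w - 1)%C ^ 2) / Cmod (1 * w + 1)%C ^ 2).
  { field. lra. }
  f_equal. rewrite !Cmod2_alt. destruct w. simpl. ring.
Qed.

Lemma half_plane_inv_disc (a w : C) : Cmod a = 1 -> 0 < Re w -> Disc (half_plane_inv a w).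
Proof.
  intros Ha Hw. apply Disc_of_sq. rewrite half_plane_inv_sq by lra.
  apply Rdiv_lt_0_compat. lra. apply pow_lt, Cmod_gt_0, half_plane_inv_den. lra.
Qed.

Lemma half_plane_inv_sub (a w w' : C) : 0 <= Re w -> 0 <= Re w' ->
  (half_plane_inv a w - half_plane_inv a w')%C =
  (a * (2 * (w - w')) / ((1 * w + 1) * (1 * w' + 1)))%C.
Proof.
  intros Hw Hw'. assert (N := half_plane_inv_den w Hw). assert (N' := half_plane_inv_den w' Hw').
  unfold half_plane_inv, moebius. field. split.
  intros E; apply N'; rewrite <- E; ring. intros E; apply N; rewrite <- E; ring.
Qed.

Lemma Cmod_half_plane_inv_sub (a w w' : C) : Cmod a = 1 -> 0 <= Re w -> 0 <= Re w' ->
  Cmod (half_plane_inv a w - half_plane_inv a w')%C =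
  2 * Cmod (w - w')%C / (Cmod (1 * w + 1)%C * Cmod (1 * w' + 1)%C).
Proof.
  intros Ha Hw Hw'. rewrite half_plane_inv_sub by assumption.
  assert (N := half_plane_inv_den w Hw). assert (N' := half_plane_inv_den w' Hw').
  rewrite Cmod_div by (apply Cmult_neq_0; assumption).
  rewrite Cmod_mult, Ha, Rmult_1_l, (Cmod_mult (1 * w + 1)), Cmod_mult, Cmod_R.
  rewrite (Rabs_pos_eq 2) by lra. reflexivity.
Qed.

Lemma half_plane_inv_lipschitz (a w w' : C) : Cmod a = 1 -> 0 <= Re w -> 0 <= Re w' ->
  Cmod (half_plane_inv a w - half_plane_inv a w')%C <= 2 * Cmod (w - w')%C.
Proof.
  intros Ha Hw Hw'. rewrite Cmod_half_plane_inv_sub by assumption.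
  assert (L : forall v, 0 <= Re v -> 1 <= Cmod (1 * v + 1)%C).
  { intros v Hv. assert (T := Rle_trans _ _ _ (Rle_abs _) (Rabs_Re_le (1 * v + 1)%C)).
    destruct v as [x y]. simpl in *. lra. }
  assert (L1 := L w Hw). assert (L2 := L w' Hw'). pose proof (Cmod_ge_0 (w - w')%C).
  assert (1 <= Cmod (1 * w + 1)%C * Cmod (1 * w' + 1)%C) by nra.
  apply Rle_trans with (2 * Cmod (w - w')%C / 1); [|right; field].
  unfold Rdiv. apply Rmult_le_compat_l; [lra|]. apply Rinv_le_contravar; lra.
Qed.

Lemma half_planeK (b z : C) : Cmod b = 1 -> Disc z -> half_plane_inv b (half_plane b z) = z.
Proof.
  intros Hb Hz. assert (N := half_plane_den b z Hb Hz).
  assert (Nb : b <> 0%C) by (intros E; rewrite E, Cmod_0 in Hb; lra).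
  unfold half_plane_inv, half_plane, moebius. field. split.
  - intros E; apply N; rewrite <- E; ring.
  - intros E. apply Nb. 
    assert (E2 : (2 * b)%C = 0%C) by (rewrite <- E; ring).
    exfalso. revert E2. apply Cmult_neq_0; [|exact Nb]. intros E2; injection E2; lra.
Qed.

(** * Horizontal rays are geodesic lines *)

(** The horizontal ray at height [t], parametrized by Poincare arc length: the hyperbolic metric of
the half-plane is [|dw| / (2 Re w)] in the normalization of [poincare_dist]. *)
Definition ray (a : C) (t s : R) : C := half_plane_inv a (exp (2 * s), t).

Lemma ray_disc (a : C) (t s : R) : Cmod a = 1 -> Disc (ray a t s).
Proof. intros Ha. apply half_plane_inv_disc. exact Ha. simpl. apply exp_pos. Qed.

Lemma Cmod_horizontal (x x' y : R) : Cmod ((x, y) - (x', y))%C = Rabs (x - x').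
Proof.
  replace ((x, y) - (x', y))%C with (RtoC (x - x')). apply Cmod_R.
  unfold RtoC, Cminus, Cplus, Copp; simpl. f_equal; ring.
Qed.

Lemma ray_sub_le (a : C) (t x x' : R) : Cmod a = 1 -> 0 <= x -> 0 <= x' ->
  Cmod (half_plane_inv a (x, t) - half_plane_inv a (x', t))%C <= 2 * Rabs (x - x').
Proof.
  intros Ha Hx Hx'. rewrite <- (Cmod_horizontal x x' t). apply half_plane_inv_lipschitz; assumption.
Qed.

Lemma poincare_ray (a : C) (t x y : R) : Cmod a = 1 -> x <= y ->
  poincare_dist (ray a t x) (ray a t y) = y - x.
Proof.
  intros Ha Hxy. apply poincare_dist_eq; try (apply ray_disc; exact Ha). lra.
  pose proof (exp_pos (2 * x)) as Px. pose proof (exp_pos (2 * y)) as Py.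
  unfold sinh2_dist, ray. rewrite !half_plane_inv_sq by (simpl; lra).
  rewrite Cmod_half_plane_inv_sub by (simpl; lra).
  rewrite Cmod_horizontal. simpl Re.
  assert (N1 := half_plane_inv_den (exp (2 * x), t) ltac:(simpl; lra)).
  assert (N2 := half_plane_inv_den (exp (2 * y), t) ltac:(simpl; lra)).
  apply Cmod_gt_0 in N1. apply Cmod_gt_0 in N2.
  set (m1 := Cmod (1 * (exp (2 * x), t) + 1)%C) in *. set (m2 := Cmod (1 * (exp (2 * y), t) + 1)%C) in *.
  unfold cosh. replace (2 * (y - x)) with (2 * y + - (2 * x)) by ring.
  rewrite Ropp_plus_distr, Ropp_involutive, !exp_plus, !exp_Ropp.
  replace ((2 * Rabs (exp (2 * x) - exp (2 * y)) / (m1 * m2)) ^ 2) with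
    (4 * (exp (2 * x) - exp (2 * y)) ^ 2 / (m1 * m2) ^ 2).
  2:{ rewrite <- (pow2_abs (exp (2 * x) - exp (2 * y))). field. lra. }
  field. lra.
Qed.

Lemma ray_limit_m_infty (a : C) (t : R) : Cmod a = 1 ->
  filterlim (ray a t) (Rbar_locally m_infty) (locally (half_plane_inv a (0, t))).
Proof.
  intros Ha P HP. apply locally_C_elim in HP. destruct HP as [eps [He HP]].
  exists (ln (eps / 2) / 2). intros s Hs. apply HP.
  unfold ray. pose proof (exp_pos (2 * s)).
  eapply Rle_lt_trans. apply ray_sub_le; lra.
  rewrite Rminus_0_r, Rabs_pos_eq by lra.
  assert (exp (2 * s) < eps / 2); [|lra].
  rewrite <- (exp_ln (eps / 2)) by lra. apply exp_increasing. lra.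
Qed.

Lemma ray_limit_p_infty (a : C) (t : R) : Cmod a = 1 ->
  filterlim (ray a t) (Rbar_locally p_infty) (locally a).
Proof.
  intros Ha P HP. apply locally_C_elim in HP. destruct HP as [eps [He HP]].
  exists (ln (2 / eps) / 2). intros s Hs. apply HP.
  pose proof (exp_pos (2 * s)) as Pe.
  assert (N := half_plane_inv_den (exp (2 * s), t) ltac:(simpl; lra)).
  unfold ray, half_plane_inv, moebius.
  replace ((a * (exp (2 * s), t) + - a) / (1 * (exp (2 * s), t) + 1) - a)%C with
    (- (2 * a / (1 * (exp (2 * s), t) + 1)))%C.
  2:{ field. intros E; apply N; rewrite <- E; ring. }
  rewrite Cmod_opp, Cmod_div, Cmod_mult, Ha, Cmod_R, Rabs_pos_eq by (exact N || lra).
  assert (L : exp (2 * s) <= Cmod (1 * (exp (2 * s), t) + 1)%C).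
  { eapply Rle_trans; [|apply Rabs_Re_le]. eapply Rle_trans; [|apply Rle_abs]. simpl. lra. }
  assert (2 / eps < exp (2 * s)).
  { rewrite <- (exp_ln (2 / eps)) by (apply Rdiv_lt_0_compat; lra). apply exp_increasing. lra. }
  apply Rmult_lt_reg_r with (Cmod (1 * (exp (2 * s), t) + 1)%C). lra.
  unfold Rdiv. rewrite Rmult_assoc, Rinv_l by lra.
  apply Rlt_le_trans with (eps * exp (2 * s)).
  - replace (2 * 1 * 1) with (eps * (2 / eps)) by (field; lra). apply Rmult_lt_compat_l; assumption.
  - apply Rmult_le_compat_l; lra.
Qed.

Lemma ray_geodesic_line (a : C) (t : R) : Cmod a = 1 -> geodesic_line Disc (ray a t).
Proof.
  intros Ha. split; [|split].
  - intros s u Hsu.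
    apply geodesic_segment_of_arclength with (h := fun s => s); [exact Hsu| |intros; apply poincare_ray; assumption].
    split; [|intros r _; apply ray_disc, Ha].
    apply (continuous_on_dominated _ (ray a t) (fun s => exp (2 * s)) 2).
    + intros x _. apply (ex_derive_continuous (fun s => exp (2 * s))). auto_derive. trivial.
    + intros x y _ _. unfold ray. pose proof (exp_pos (2 * x)). pose proof (exp_pos (2 * y)).
      apply ray_sub_le; lra.
  - exists (half_plane_inv a (0, t)). split; [|apply ray_limit_m_infty, Ha].
    apply frontier_disc. assert (S := half_plane_inv_sq a (0, t) Ha ltac:(simpl; lra)).
    simpl Re in S. pose proof (Cmod_ge_0 (half_plane_inv a (0, t))). unfold Rdiv in S. rewrite Rmult_0_r, Rmult_0_l in S. nra.
  - exists a. split. apply frontier_disc, Ha. apply ray_limit_p_infty, Ha.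
Qed.

Lemma ray_through (a : C) (t : R) : Cmod a = 1 ->
  geodesics_through Disc a (fun z => exists s : R, z = ray a t s).
Proof.
  intros Ha. split.
  - exists (ray a t). split. apply ray_geodesic_line, Ha. reflexivity.
  - intros P HP. destruct (ray_limit_p_infty a t Ha P HP) as [M HM].
    exists (ray a t (M + 1)). split. apply HM; lra. exists (M + 1). reflexivity.
Qed.

(** * Geodesic lines ending at a boundary point are horizontal *)

(** When [|b| = 1], the determinant with [b] as its third point is the cross product of the two
fractions in [Im_half_plane]. *)
Lemma Im_half_plane_eq_of_collinear (b p q : C) : Cmod b = 1 -> Disc p -> Disc q ->
  collinearity p q b = 0 -> Im (half_plane b p) = Im (half_plane b q).
Proof.
  intros Hb Hp Hq H. rewrite !Im_half_plane by assumption.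
  assert (Np := half_plane_den b p Hb Hp). assert (Nq := half_plane_den b q Hb Hq).
  apply Cmod_gt_0 in Np. apply Cmod_gt_0 in Nq.
  replace (- (1) * p + b)%C with (b - p)%C in Np by ring.
  replace (- (1) * q + b)%C with (b - q)%C in Nq by ring.
  assert (K : (Re b * Im p - Im b * Re p) * Cmod (b - q)%C ^ 2 = (Re b * Im q - Im b * Re q) * Cmod (b - p)%C ^ 2).
  { assert (Hb2 : Cmod b ^ 2 = 1) by (rewrite Hb; ring). rewrite Cmod2_alt in Hb2.
    rewrite !Cmod2_alt. apply Rminus_diag_uniq. unfold collinearity in H. rewrite <- H.
    destruct b as [b1 b2], p as [p1 p2], q as [q1 q2]. simpl in *.
    assert (E : b1 * b1 = 1 - b2 * b2) by lra. ring [E]. }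
  apply Rmult_eq_reg_r with (Cmod (b - p)%C ^ 2 * Cmod (b - q)%C ^ 2).
  2:{ apply Rgt_not_eq, Rmult_lt_0_compat; apply pow_lt; assumption. }
  field_simplify; try lra.
Qed.

(** Passage to the limit [r -> b] in a polynomial relation. Since [p] and [q] lie in the disc, each of
the three terms of the difference is at most [4 |r - b|], whence the constant 12. *)
Lemma collinear_limit (Gamma : C -> Prop) (b p q : C) : Cmod b = 1 -> Disc p -> Disc q ->
  (forall r, Gamma r -> Disc r /\ collinearity p q r = 0) -> closure Gamma b -> collinearity p q b = 0.
Proof.
  intros Hb Hp Hq HG Hcl.
  destruct (Req_dec (collinearity p q b) 0) as [|Hn]; [assumption|exfalso].
  assert (Hpos := Rabs_pos_lt _ Hn).
  destruct (Hcl _ (locally_Cmod b (Rabs (collinearity p q b) / 12) ltac:(lra))) as [r [R1 R2]].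
  destruct (HG r R2) as [Hr Er].
  set (eps := Cmod (r - b)%C) in *.
  assert (Dx : Rabs (Re r - Re b) <= eps) by (apply (Rabs_Re_le (r - b)%C)).
  assert (Dy : Rabs (Im r - Im b) <= eps) by (apply (Rabs_Im_le (r - b)%C)).
  assert (Dn : Rabs (Cmod r ^ 2 - Cmod b ^ 2) <= 2 * eps).
  { assert (T1 : Cmod b <= Cmod r + eps).
    { replace b with (r + - (r - b))%C at 1 by ring. eapply Rle_trans. apply Cmod_triangle. rewrite Cmod_opp. apply Rle_refl. }
    assert (T2 : Cmod r < 1) by exact Hr. pose proof (Cmod_ge_0 r).
    rewrite Hb in *. apply Rabs_le. split; nra. }
  assert (Bp := Rabs_Re_le p). assert (Bp' := Rabs_Im_le p).
  assert (Bq := Rabs_Re_le q). assert (Bq' := Rabs_Im_le q).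
  assert (Gp := Cmod_sq_lt1 p Hp). assert (Gq := Cmod_sq_lt1 q Hq). unfold Disc in *.
  rewrite !Cmod2_alt in *.
  assert (E : collinearity p q b = collinearity p q b - collinearity p q r) by (rewrite Er; ring).
  assert (E' : collinearity p q b - collinearity p q r =
    - ((1 + Re p ^ 2 + Im p ^ 2) * (Re q * (Im r - Im b) - Im q * (Re r - Re b)))
    + (1 + Re q ^ 2 + Im q ^ 2) * (Re p * (Im r - Im b) - Im p * (Re r - Re b))
    - (Re r ^ 2 + Im r ^ 2 - (Re b ^ 2 + Im b ^ 2)) * (Re p * Im q - Im p * Re q)) by (unfold collinearity; ring).
  assert (Bd : forall u v x y, Rabs u <= 1 -> Rabs v <= 1 -> Rabs x <= eps -> Rabs y <= eps -> Rabs (u * x - v * y) <= 2 * eps).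
  { intros u v x y Hu Hv Hx Hy. unfold Rminus. eapply Rle_trans. apply Rabs_triang.
    rewrite Rabs_Ropp, !Rabs_mult. pose proof (Rabs_pos u). pose proof (Rabs_pos v).
    pose proof (Rabs_pos x). pose proof (Rabs_pos y). nra. }
  assert (B1 := Bd (Re q) (Im q) _ _ ltac:(lra) ltac:(lra) Dy Dx).
  assert (B2 := Bd (Re p) (Im p) _ _ ltac:(lra) ltac:(lra) Dy Dx).
  assert (B3 : Rabs (Re p * Im q - Im p * Re q) <= 2).
  { unfold Rminus. eapply Rle_trans. apply Rabs_triang. rewrite Rabs_Ropp, !Rabs_mult.
    pose proof (Rabs_pos (Re p)). pose proof (Rabs_pos (Im p)). pose proof (Rabs_pos (Re q)). pose proof (Rabs_pos (Im q)). nra. }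
  assert (HR : Rabs (collinearity p q b) <= 12 * eps).
  { rewrite E, E'. unfold Rminus at 1. eapply Rle_trans. apply Rabs_triang.
    eapply Rle_trans. apply Rplus_le_compat_r. apply Rabs_triang.
    rewrite !Rabs_Ropp, !Rabs_mult.
    rewrite (Rabs_pos_eq (1 + Re p ^ 2 + Im p ^ 2)) by nra.
    rewrite (Rabs_pos_eq (1 + Re q ^ 2 + Im q ^ 2)) by nra.
    pose proof (Rabs_pos (Re q * (Im r - Im b) - Im q * (Re r - Re b))).
    pose proof (Rabs_pos (Re p * (Im r - Im b) - Im p * (Re r - Re b))).
    pose proof (Rabs_pos (Re p * Im q - Im p * Re q)).
    pose proof (Rabs_pos (Re r ^ 2 + Im r ^ 2 - (Re b ^ 2 + Im b ^ 2))).
    assert ((1 + Re p ^ 2 + Im p ^ 2) * Rabs (Re q * (Im r - Im b) - Im q * (Re r - Re b)) <= 2 * (2 * eps)) by (apply Rmult_le_compat; nra).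
    assert ((1 + Re q ^ 2 + Im q ^ 2) * Rabs (Re p * (Im r - Im b) - Im p * (Re r - Re b)) <= 2 * (2 * eps)) by (apply Rmult_le_compat; nra).
    assert (Rabs (Re r ^ 2 + Im r ^ 2 - (Re b ^ 2 + Im b ^ 2)) * Rabs (Re p * Im q - Im p * Re q) <= 2 * eps * 2) by (apply Rmult_le_compat; lra).
    lra. }
  lra.
Qed.

(** Geodesic lines through [b] are contained in horizontal rays: any two of their points are collinear
with [b], as a limit of points of the same line. *)
Lemma Im_half_plane_const (b : C) (Gamma : C -> Prop) : Cmod b = 1 -> geodesics_through Disc b Gamma ->
  forall p q, Gamma p -> Gamma q -> Im (half_plane b p) = Im (half_plane b q).
Proof.
  intros Hb [(gamma & Hg & HG) Hcl] p q Hp Hq.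
  assert (HD : forall z, Gamma z -> Disc z).
  { intros z Hz. apply HG in Hz. destruct Hz as [r ->]. apply (proj1 Hg r r (Rle_refl r)). lra. }
  apply Im_half_plane_eq_of_collinear; try assumption; try (apply HD; assumption).
  apply (collinear_limit Gamma); try assumption; try (apply HD; assumption).
  intros r Hr. split. apply HD, Hr.
  apply HG in Hp; apply HG in Hq; apply HG in Hr.
  destruct Hp as [r1 ->], Hq as [r2 ->], Hr as [r3 ->]. apply geodesic_line_collinear, Hg.
Qed.

(** * Maps preserving horizontal rays are affine *)

Lemma const_of_derive_0 (g : R -> R) (a b : R) :
  (forall t, Rmin a b <= t <= Rmax a b -> is_derive g t 0) -> g a = g b.
Proof.
  intros H. destruct (Rtotal_order a b) as [L|[->|L]]; [|reflexivity|symmetry].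
  - apply (eq_is_derive g); [|exact L]. intros t Ht. apply H. rewrite Rmin_left, Rmax_right; lra.
  - apply (eq_is_derive g); [|exact L]. intros t Ht. apply H. rewrite Rmin_right, Rmax_left; lra.
Qed.

Lemma affine_of_derive_const (g : R -> R) (k a b : R) :
  (forall t, Rmin a b <= t <= Rmax a b -> is_derive g t k) -> g b = g a + k * (b - a).
Proof.
  intros H. assert (E : g a - k * a = g b - k * b); [|lra].
  apply (const_of_derive_0 (fun t => g t - k * t)).
  intros t Ht. replace 0 with (k - k * 1) by ring.
  apply (is_derive_minus g (fun t => k * t)). apply H, Ht.
  apply is_derive_scal, (is_derive_id (K := R_AbsRing)).
Qed.

(** In [HD], [m] is the complex derivative, which is real since [Im F] is constant horizontally. It
is at once the derivative of [Re F] in [x] and of [Im F] in [y]; the former depends on [x] only and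
the latter on [y] only. *)
Lemma affine_of_Im_horizontal (F : C -> C) :
  (forall w, 0 < Re w -> exists l, cdiff F w l) ->
  (forall x x' y, 0 < x -> 0 < x' -> Im (F (x, y)) = Im (F (x', y))) ->
  exists (k : R) (c : C), forall w, 0 < Re w -> F w = (k * w + c)%C.
Proof.
  intros HF HI.
  assert (HD : forall x y, 0 < x -> exists m : R,
    is_derive (fun s => Re (F (s, y))) x m /\ is_derive (fun s => Re (F (x, s))) y 0 /\
    is_derive (fun s => Im (F (x, s))) y m).
  { intros x y Hx. destruct (HF (x, y) Hx) as [l Hl].
    assert (Ex : forall s : R, ((0, y) + s * 1)%C = (s, y)).
    { intros s. unfold Cplus, Cmult, RtoC; simpl. f_equal; ring. }
    assert (Ey : forall s : R, ((x, 0) + s * Ci)%C = (x, s)).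
    { intros s. unfold Cplus, Cmult, RtoC, Ci; simpl. f_equal; ring. }
    assert (D1 := fun k => is_derive_Re_line F (0, y) 1 k l x). rewrite Ex in D1.
    assert (D2 := fun k => is_derive_Re_line F (x, 0) Ci k l y). rewrite Ey in D2.
    assert (Im_l : Im l = 0).
    { assert (D := D1 (- Ci)%C Hl).
      assert (D' : is_derive (fun _ : R => Im (F (x, y))) x (Re (- Ci * (l * 1))%C)).
      { apply (is_derive_ext_loc (fun s : R => Re (- Ci * F ((0, y) + s * 1))%C)); [|exact D].
        exists (mkposreal x Hx). intros s Hs. rewrite Ex.
        change (Rabs (s - x) < x) in Hs. apply Rabs_def2 in Hs.
        rewrite <- (HI s x y) by lra. unfold Ci, Re, Im; simpl. unfold Re, Im; simpl. ring. }
      assert (E := is_derive_unique _ _ _ D'). rewrite Derive_const in E.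
      unfold Ci in E. destruct l as [l1 l2]. simpl in *. lra. }
    exists (Re l). split; [|split].
    - assert (D := D1 1%C Hl). replace (Re (1 * (l * 1))%C) with (Re l) in D by (f_equal; ring).
      refine (is_derive_ext _ _ _ _ _ D). intros s. cbv beta. rewrite Ex, Cmult_1_l. reflexivity.
    - assert (D := D2 1%C Hl). replace (Re (1 * (l * Ci))%C) with 0 in D.
      refine (is_derive_ext _ _ _ _ _ D). intros s. cbv beta. rewrite Ey, Cmult_1_l. reflexivity.
      destruct l as [l1 l2]. unfold Ci. simpl in *. rewrite Im_l. ring.
    - assert (D := D2 (- Ci)%C Hl). replace (Re (- Ci * (l * Ci))%C) with (Re l) in D.
      refine (is_derive_ext _ _ _ _ _ D). intros s. rewrite Ey. unfold Ci, Re, Im; simpl. unfold Re, Im; simpl. ring.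
      destruct l as [l1 l2]. unfold Ci. simpl in *. ring. }
  assert (HR : forall x y, 0 < x -> Re (F (x, y)) = Re (F (x, 0))).
  { intros x y Hx. apply (const_of_derive_0 (fun s => Re (F (x, s)))).
    intros t _. destruct (HD x t Hx) as (m & _ & D & _). exact D. }
  (* the derivatives at the base point [1 + 0 i] determine all the others *)
  destruct (HD 1 0 Rlt_0_1) as (k & K1 & _ & K2).
  assert (Hm : forall x, 0 < x -> is_derive (fun s => Re (F (s, 0))) x k).
  { intros x Hx. destruct (HD x 0 Hx) as (m & M1 & _ & M2).
    replace k with m; [exact M1|].
    rewrite <- (is_derive_unique _ _ _ M2), <- (is_derive_unique _ _ _ K2).
    apply Derive_ext. intros s. apply HI; lra. }
  assert (Hk : forall y, is_derive (fun s => Im (F (1, s))) y k).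
  { intros y. destruct (HD 1 y Rlt_0_1) as (m & M1 & _ & M2).
    replace k with m; [exact M2|].
    rewrite <- (is_derive_unique _ _ _ M1), <- (is_derive_unique _ _ _ K1).
    apply Derive_ext_loc. exists (mkposreal 1 Rlt_0_1). intros s Hs.
    change (Rabs (s - 1) < 1) in Hs. apply Rabs_def2 in Hs. apply HR. lra. }
  exists k, (F (1, 0) - k)%C. intros [x y] Hx. simpl in Hx.
  assert (ER : Re (F (x, y)) = Re (F (1, 0)) + k * (x - 1)).
  { rewrite (HR x y Hx). apply (affine_of_derive_const (fun s => Re (F (s, 0)))).
    intros t Ht. apply Hm. assert (0 < Rmin 1 x) by (apply Rmin_pos; lra). lra. }
  assert (EI : Im (F (x, y)) = Im (F (1, 0)) + k * (y - 0)).
  { rewrite (HI x 1 y) by lra. apply (affine_of_derive_const (fun s => Im (F (1, s)))).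
    intros t _. apply Hk. }
  destruct (F (x, y)) as [u v], (F (1, 0)) as [u0 v0]. simpl in *. subst.
  unfold Cplus, Cminus, Cmult, Copp, RtoC; simpl. f_equal; ring.
Qed.

(** Test at a large [x] for the slope and at a small [x] for the constant term. *)
Lemma affine_half_plane_coeffs (k c : R) : (forall x, 0 < x -> 0 < k * x + c) -> 0 <= k /\ 0 <= c.
Proof.
  intros H. split.
  - destruct (Rle_lt_dec 0 k) as [|Hk]; [assumption|exfalso].
    assert (P := H ((1 + Rabs c) / - k) ltac:(apply Rdiv_lt_0_compat; [pose proof (Rabs_pos c)|]; lra)).
    replace (k * ((1 + Rabs c) / - k)) with (- (1 + Rabs c)) in P by (field; lra).
    pose proof (Rle_abs c). lra.
  - destruct (Rle_lt_dec 0 c) as [|Hc]; [assumption|exfalso].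
    assert (Hk : 0 < 1 + Rabs k) by (pose proof (Rabs_pos k); lra).
    assert (X : 0 < - c / (1 + Rabs k)) by (apply Rdiv_lt_0_compat; lra).
    assert (P := H _ X). pose proof (Rle_abs k).
    assert (E : (1 + Rabs k) * (- c / (1 + Rabs k)) = - c) by (field; lra). nra.
Qed.

Lemma geodesic_preserving_half_plane (a b : C) (f : C -> C) : Cmod a = 1 -> Cmod b = 1 ->
  geodesic_preserving Disc Disc (geodesics_through Disc a) (geodesics_through Disc b) f ->
  exists (k : R) (c : C), 0 <= k /\ 0 <= Re c /\
    forall z, Disc z -> half_plane b (f z) = (k * half_plane a z + c)%C.
Proof.
  intros Ha Hb [Hf HG]. apply disc_self_map_of_holomorphic in Hf.
  set (F := fun w => half_plane b (f (half_plane_inv a w))).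
  assert (HD : forall w, 0 < Re w -> Disc (f (half_plane_inv a w))).
  { intros w Hw. apply Hf, half_plane_inv_disc; assumption. }
  destruct (affine_of_Im_horizontal F) as (k & c & HF).
  - intros w Hw.
    destruct (proj1 Hf _ (half_plane_inv_disc a w Ha Hw)) as [l Hl].
    assert (C1 := cdiff_moebius a (- a) 1 1 w (half_plane_inv_den w (Rlt_le _ _ Hw))).
    assert (C2 := cdiff_comp f (half_plane_inv a) w l _ C1 Hl).
    assert (C3 := cdiff_moebius 1 b (- (1)) b _ (half_plane_den b _ Hb (HD w Hw))).
    eexists. exact (cdiff_comp (half_plane b) (fun w => f (half_plane_inv a w)) w _ _ C2 C3).
  - intros x x' y Hx Hx'.
    destruct (HG _ (ray_through a y Ha)) as (Gamma & HGamma & Hin).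
    assert (Hray : forall v, 0 < v -> Gamma (f (half_plane_inv a (v, y)))).
    { intros v Hv. apply Hin. exists (ln v / 2). unfold ray.
      replace (2 * (ln v / 2)) with (ln v) by field. rewrite exp_ln by exact Hv. reflexivity. }
    apply (Im_half_plane_const b Gamma Hb HGamma); apply Hray; assumption.
  - exists k, c.
    assert (HP : forall x, 0 < x -> 0 < k * x + Re c).
    { intros x Hx. assert (E := HF (x, 0) Hx). apply (f_equal Re) in E.
      replace (k * x + Re c) with (Re (k * (x, 0) + c)%C) by (destruct c; simpl; ring).
      rewrite <- E. unfold F. assert (D := HD (x, 0) Hx). rewrite Re_half_plane by assumption.
      apply Rdiv_lt_0_compat. apply Cmod_sq_lt1, D.
      apply pow_lt. assert (N := half_plane_den b _ Hb D). apply Cmod_gt_0 in N.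
      match goal with |- 0 < Cmod ?X => replace X with (- (1) * f (half_plane_inv a (x, 0%R)) + b)%C by ring end. exact N. }
    destruct (affine_half_plane_coeffs _ _ HP) as [Hk Hc].
    repeat split; try assumption. intros z Hz.
    rewrite <- HF. unfold F. rewrite half_planeK by assumption. reflexivity.
    rewrite Re_half_plane by assumption. apply Rdiv_lt_0_compat. apply Cmod_sq_lt1, Hz.
    apply pow_lt. assert (N := half_plane_den a z Ha Hz). apply Cmod_gt_0 in N.
    replace (a - z)%C with (- (1) * z + a)%C by ring. exact N.
Qed.

Theorem theorem2 (a b : C) (ha : frontier Disc a) (hb : frontier Disc b)
    (f : C -> C)
    (hnonconst : ~ (exists c : C, forall z : C, Disc z -> f z = c))
    (hf : geodesic_preserving Disc Disc
            (geodesics_through Disc a) (geodesics_through Disc b) f) :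
  exists sigma T : C -> C,
    rotation sigma /\ sigma a = b /\
    moebius_self_map T /\ T a = a /\
    (forall z : C, Disc z -> f z = sigma (T z)).
Proof.
  apply frontier_disc in ha. apply frontier_disc in hb.
  destruct (geodesic_preserving_half_plane a b f ha hb hf) as (k & c & Hk & Hc & Hf).
  assert (HfD : forall z, Disc z -> Disc (f z)) by apply hf.
  assert (Na : a <> 0%C) by (intros E; rewrite E, Cmod_0 in ha; lra).
  assert (Hk' : 0 < k).
  { destruct Hk as [|E]; [assumption|exfalso]. apply hnonconst.
    exists (half_plane_inv b c). intros z Hz.
    rewrite <- (half_planeK b (f z) hb (HfD z Hz)), (Hf z Hz), <- E. f_equal. ring. }
  assert (Nk : RtoC k <> 0%C) by (intros E; injection E; lra).
  assert (N2 : RtoC 2 <> 0%C) by (intros E; injection E; lra).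
  (* [T] is [half_plane_inv a (k w + c)] for [w = half_plane a z], with the factor [a - z] cleared;
     its denominator is [2 k a] at [a], and elsewhere it vanishes only if [k w + c = - 1], which is
     impossible when [Re w >= 0] *)
  assert (Den : forall z, Cmod z <= 1 -> ((k - c - 1) * z + a * (k + c + 1))%C <> 0%C).
  { intros z Hz E.
    replace ((k - c - 1) * z + a * (k + c + 1))%C with (k * (a + z) + (c + 1) * (a - z))%C in E by ring.
    assert (E1 : Re ((k * (a + z) + (c + 1) * (a - z)) * Cconj (a - z))%C = 0) by (rewrite E; simpl; ring).
    assert (E2 : k * (1 - Cmod z ^ 2) + (Re c + 1) * Cmod (a - z)%C ^ 2 = 0).
    { rewrite <- E1. replace (1 - Cmod z ^ 2) with (Cmod a ^ 2 - Cmod z ^ 2) by (rewrite ha; ring).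
      rewrite !Cmod2_alt. destruct a as [a1 a2], z as [z1 z2], c as [c1 c2]. simpl. ring. }
    pose proof (Cmod_ge_0 z). pose proof (Cmod_ge_0 (a - z)%C).
    assert (0 <= k * (1 - Cmod z ^ 2)) by (apply Rmult_le_pos; nra).
    assert (E3 : Cmod (a - z)%C = 0) by nra.
    apply Cmod_eq_0 in E3. rewrite E3 in E. replace z with a in E.
    2:{ replace a with (a - z + z)%C by ring. rewrite E3. ring. }
    assert (E4 : (k * (2 * a))%C = 0%C) by (rewrite <- E; ring).
    revert E4. repeat apply Cmult_neq_0; assumption. }
  set (sigma := fun z : C => (b / a * z)%C).
  set (T := moebius (a * (k - c + 1)) (a * a * (k + c - 1)) (k - c - 1) (a * (k + c + 1))).
  assert (HT : forall z, Disc z -> f z = sigma (T z)).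
  { intros z Hz. rewrite <- (half_planeK b (f z) hb (HfD z Hz)), (Hf z Hz).
    assert (Nz := half_plane_den a z ha Hz). assert (Nd := Den z (Rlt_le _ _ Hz)).
    unfold sigma, T, half_plane, half_plane_inv, moebius. field. repeat split; try assumption.
    intros E; apply Nz; rewrite <- E; ring. }
  assert (Hs : Cmod (b / a)%C = 1) by (rewrite Cmod_div, ha, hb by exact Na; field).
  exists sigma, T. repeat split.
  - exists (b / a)%C. split; [exact Hs|reflexivity].
  - unfold sigma. field. exact Na.
  - exists (a * (k - c + 1))%C, (a * a * (k + c - 1))%C, (k - c - 1)%C, (a * (k + c + 1))%C.
    split.
    + replace (a * (k - c + 1) * (a * (k + c + 1)) - a * a * (k + c - 1) * (k - c - 1))%C
        with (2 * 2 * k * (a * a))%C by ring.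
      repeat apply Cmult_neq_0; assumption.
    + intros z Hz. split; [apply Den, Hz|reflexivity].
  - intros z Hz. unfold Disc. replace (Cmod (T z)) with (Cmod (sigma (T z))).
    rewrite <- HT by exact Hz. apply HfD, Hz.
    unfold sigma. rewrite Cmod_mult, Hs. ring.
  - unfold T, moebius. assert (Nd := Den a (Req_le _ _ ha)).
    field. exact Nd.
  - exact HT.
Qed.
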